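(* For $\mathcal S=\{(0,1),(1,-1),(-1,-1),(-2,1),(-1,0)\}$, the generating function of quadrant walks with steps in $\mathcal S$ is $$Q(x,y)=[x^{\ge}y^{\ge}]\frac{(y^2-x)(x^2y^2-xy-y^2-2x)(x^3-xy-2y^2-x)}{x^5y^4\left(1-t(y+x\bar y+\bar x\bar y+\bar x^2y+\bar x)\right)},$$ where the right-hand side is seen as a power series in $t$ with coefficients in $\mathbb Q[x,\bar x,y,\bar y]$. The excursion exponent $\alpha_e$ and the walk exponent $\alpha_w$ are both $-4$.
   Context: $\bar x=1/x$, $\bar y=1/y$, $\mathbb N=\{0,1,2,\ldots\}$. $Q(x,y)\equiv Q(x,y;t)=\sum_{i,j,n\ge0}q(i,j;n)x^iy^jt^n$, where $q(i,j;n)$ is the number of $n$-step walks with steps in $\mathcal S$ from $(0,0)$ to $(i,j)$ staying in $\mathbb N^2$. $[x^\ge y^\ge]$ keeps only the monomials $x^iy^jt^n$ with $i,j\ge0$. The excursion exponent $\alpha_e$ is the exponent of $n$ in the asymptotic behaviour of the number of quadrant excursions: with $p$ the period of the model (the gcd of the lengths of walks with steps in $\mathcal S$, not confined to the quadrant, from the origin to itself), there are $\mu>0$ and constants $\kappa_1,\kappa_2>0$ with $\kappa_1\mu^nn^{\alpha_e}\le q(0,0;n)\le\kappa_2\mu^nn^{\alpha_e}$ for all large $n$ divisible by $p$. The walk exponent $\alpha_w$ is the exponent of $n$ in the asymptotic behaviour of the total number $q_n=\sum_{i,j}q(i,j;n)$ of $n$-step quadrant walks: $q_n\sim C_n\rho^nn^{\alpha_w}$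 for some $\rho>0$ and some positive sequence $C_n$ that is periodic (possibly constant) in $n$. *)

(* Defs.v *)
From HB Require Import structures.
From mathcomp Require Import all_boot all_order all_algebra finmap.
From mathcomp.multinomials Require Import monalg.
From mathcomp Require Import all_classical all_reals all_analysis.
Set Implicit Arguments. Unset Strict Implicit. Unset Printing Implicit Defensive.
Import Order.TTheory GRing.Theory Num.Theory.
Import numFieldNormedType.Exports.
Local Open Scope fset_scope.
Local Open Scope ring_scope.

Local Notation lmalg := {malg rat[(int * int)%type]}.

Section Convolution.
Implicit Types f g h : lmalg.

Definition lmul f g : lmalg :=
  \sum_(k <- msupp f) \sum_(l <- msupp g) << f@_k * g@_l *g k + l >>.

Lemma lmulEw (d e : {fset (int * int)%type}) f g : msupp f `<=` d ->
  msupp g `<=` e ->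
  lmul f g = \sum_(k <- d) \sum_(l <- e) << f@_k * g@_l *g k + l >>.
Proof.
move=> le_d le_e; rewrite /lmul (big_fset_incl _ le_d) /=.
  apply/eq_bigr=> k1 _; apply/big_fset_incl => // k _ /mcoeff_outdom ->.
  by rewrite mulr0 monalgU0.
move=> k _ /mcoeff_outdom fk.
by rewrite big1 => // k' _; rewrite fk mul0r monalgU0.
Qed.

Lemma lmulC : commutative lmul.
Proof.
move=> f g; rewrite /lmul exchange_big /=.
by do 2![apply: eq_bigr => ? _]; rewrite mulrC addrC.
Qed.

Lemma lmulDl : left_distributive lmul +%R.
Proof.
move=> g1 g2 g.
have s1 := fsubsetUl (msupp g1) (msupp g2).
have s2 := fsubsetUr (msupp g1) (msupp g2).
rewrite (lmulEw s1 (fsubset_refl _)) (lmulEw s2 (fsubset_refl _)).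
rewrite (lmulEw (msuppD_le _ _) (fsubset_refl _)) -big_split /=.
apply/eq_bigr=> k1 _; rewrite -big_split /=; apply/eq_bigr=> k2 _.
by rewrite mcoeffD mulrDl monalgUD.
Qed.

Lemma lmul0 f : lmul 0 f = 0.
Proof. by rewrite /lmul msupp0 big_seq_fset0. Qed.

Lemma lmulUU c1 c2 k1 k2 :
  lmul << c1 *g k1 >> << c2 *g k2 >> = << c1 * c2 *g k1 + k2 >>.
Proof. by rewrite (lmulEw msuppU_le msuppU_le) !big_seq_fset1 !mcoeffUU. Qed.

Lemma lmul_suml (I : Type) (r : seq I) (F : I -> lmalg) g :
  lmul (\sum_(i <- r) F i) g = \sum_(i <- r) lmul (F i) g.
Proof. exact: (big_morph (lmul^~ g) (fun _ _ => lmulDl _ _ _) (lmul0 g)). Qed.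

Lemma lmul_sumr (I : Type) (r : seq I) (F : I -> lmalg) g :
  lmul g (\sum_(i <- r) F i) = \sum_(i <- r) lmul g (F i).
Proof. by rewrite lmulC lmul_suml; apply: eq_bigr => i _; rewrite lmulC. Qed.

Lemma lmulA : associative lmul.
Proof.
move=> f g h; rewrite (monalgE f) lmul_suml.
rewrite [lmul (\sum_(i <- _) _) g]lmul_suml lmul_suml; apply: eq_bigr => k _.
rewrite (monalgE g) [lmul (\sum_(i <- _) _) h]lmul_suml !lmul_sumr.
rewrite lmul_suml; apply: eq_bigr => l _.
rewrite lmulUU (monalgE h) [lmul << g@_l *g l >> _]lmul_sumr !lmul_sumr.
by apply: eq_bigr => m _; rewrite !lmulUU mulrA addrA.
Qed.

Lemma lmul1 : left_id << (0, 0) >> lmul.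
Proof.
move=> g; rewrite [in LHS](monalgE g) lmul_sumr [RHS]monalgE.
by apply: eq_bigr => k _; rewrite lmulUU mul1r add0r.
Qed.

End Convolution.

(* The ring Q[x, 1/x, y, 1/y]: finitely supported maps from exponents in Z^2 to
   rat, with the convolution product.  monalg.v only provides that product for
   monoids without nontrivial units, hence the wrapper. *)
Record laurent := Laurent { lval : lmalg }.

HB.instance Definition _ := [isNew for lval].
HB.instance Definition _ := [Choice of laurent by <:].

Definition lcoef (f : laurent) (k : (int * int)%type) : rat := (lval f)@_k.

(* The monomial x^i y^j, for k = (i, j).  It and the product are locked so that
   unification does not unfold them. *)
HB.lock Definition lmono (k : (int * int)%type) : laurent := Laurent << k >>.

HB.lock Definition lprod (f g : laurent) : laurent :=
  Laurent (lmul (lval f) (lval g)).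

Section LaurentRing.
Implicit Types f g h : laurent.

Definition lzero := Laurent 0.
Definition lopp f := Laurent (- lval f).
Definition ladd f g := Laurent (lval f + lval g).

Lemma laddA : associative ladd.
Proof. by move=> f g h; congr Laurent; rewrite addrA. Qed.

Lemma laddC : commutative ladd.
Proof. by move=> f g; congr Laurent; rewrite addrC. Qed.

Lemma ladd0 : left_id lzero ladd.
Proof. by move=> f; apply: val_inj; rewrite /= add0r. Qed.

Lemma laddN : left_inverse lzero lopp ladd.
Proof. by move=> f; congr Laurent; rewrite addNr. Qed.

HB.instance Definition _ := GRing.isZmodule.Build laurent
  laddA laddC ladd0 laddN.

Lemma lprodA : associative lprod.
Proof. by move=> f g h; rewrite lprod.unlock /= lmulA. Qed.

Lemma lprodC : commutative lprod.
Proof. by move=> f g; rewrite lprod.unlock lmulC. Qed.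

Lemma lprod1 : left_id (lmono (0, 0)) lprod.
Proof.
by move=> f; apply: val_inj; rewrite lprod.unlock lmono.unlock /= lmul1.
Qed.

Lemma lprodDl : left_distributive lprod +%R.
Proof. by move=> f g h; rewrite lprod.unlock /= lmulDl. Qed.

Lemma lmono00_neq0 : lmono (0, 0) != 0.
Proof.
apply/eqP => /(congr1 lval) /(congr1 (mcoeff (0, 0))) /eqP.
by rewrite lmono.unlock mcoeffUU mcoeff0.
Qed.

HB.instance Definition _ := GRing.Zmodule_isComNzRing.Build laurent
  lprodA lprodC lprod1 lprodDl lmono00_neq0.

Lemma lmulE f g : f * g = Laurent (lmul (lval f) (lval g)).
Proof. by transitivity (lprod f g); last rewrite lprod.unlock. Qed.

Lemma lcoefP f g : lcoef f =1 lcoef g <-> f = g.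
Proof. by split=> [fg|-> //]; apply: val_inj; exact/malgP. Qed.

Lemma lcoefD f g k : lcoef (f + g) k = lcoef f k + lcoef g k.
Proof. exact: mcoeffD. Qed.

Lemma lcoefM f g k : lcoef (f * g) k =
  \sum_(l <- msupp (lval f)) \sum_(m <- msupp (lval g))
    (lcoef f l * lcoef g m) *+ (l + m == k).
Proof.
rewrite lmulE /lcoef /= /lmul raddf_sum; apply: eq_bigr => l _ /=.
by rewrite raddf_sum; apply: eq_bigr => m _ /=; rewrite mcoeffU.
Qed.

Lemma lmonoE k l : lcoef (lmono k) l = (k == l)%:R.
Proof. by rewrite lmono.unlock /lcoef mcoeffU. Qed.

Lemma lmonoD k l : lmono (k + l) = lmono k * lmono l.
Proof.
rewrite lmulE lmono.unlock.
by congr Laurent; rewrite lmulUU mulr1.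
Qed.

End LaurentRing.

Notation lx := (lmono (1, 0)).
Notation ly := (lmono (0, 1)).
Notation lxV := (lmono (-1, 0)).
Notation lyV := (lmono (0, -1)).

Lemma lxK : lx * lxV = 1.
Proof. by rewrite -lmonoD. Qed.

Lemma lyK : ly * lyV = 1.
Proof. by rewrite -lmonoD. Qed.

Definition in_quadrant (k : (int * int)%type) : bool :=
  (0 <= k.1) && (0 <= k.2).

(* The operator [x^>= y^>=], on one coefficient of a series in t. *)
Definition nonneg_part (g : laurent) : laurent :=
  Laurent [malg k in msupp (lval g) => if in_quadrant k then lcoef g k else 0].

Lemma nonneg_partE g k :
  lcoef (nonneg_part g) k = if in_quadrant k then lcoef g k else 0.
Proof. by rewrite /lcoef mcoeffE; case: msuppP => // _; rewrite if_same. Qed.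

(* Power series in t over A, given by their coefficients. *)
Section PowerSeries.
Variable A : comNzRingType.
Implicit Types F G : nat -> A.

Definition ps_const (a : A) : nat -> A := fun n => if n == 0%N then a else 0.

Definition ps_t : nat -> A := fun n => (n == 1%N)%:R.

Definition ps_sub F G : nat -> A := fun n => F n - G n.

Definition ps_mul F G : nat -> A :=
  fun n => \sum_(i < n.+1) F i * G (n - i)%N.

Fixpoint ps_inv_rec F n : seq A :=
  if n isn't m.+1 then [:: 1]
  else let s := ps_inv_rec F m in
       rcons s (- \sum_(i < m.+1) F i.+1 * s`_(m - i)).

(* The inverse of a series with constant coefficient 1. *)
Definition ps_inv F : nat -> A := fun n => (ps_inv_rec F n)`_n.

Lemma size_ps_inv_rec F n : size (ps_inv_rec F n) = n.+1.
Proof. by elim: n => //= n IH; rewrite size_rcons IH. Qed.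

Lemma ps_inv_recE F n k : (k <= n)%N -> (ps_inv_rec F n)`_k = ps_inv F k.
Proof.
elim: n => [|n IH]; first by rewrite leqn0 => /eqP ->.
rewrite leq_eqVlt ltnS => /orP[/eqP -> //|le_kn].
by rewrite /= nth_rcons size_ps_inv_rec ltnS le_kn IH.
Qed.

Lemma ps_mulV F : F 0%N = 1 -> ps_mul F (ps_inv F) =1 ps_const 1.
Proof.
move=> F0 [|n]; rewrite /ps_mul big_ord_recl F0 mul1r subn0.
  by rewrite big_ord0 addr0.
rewrite {1}/ps_inv /= nth_rcons size_ps_inv_rec ltnn eqxx.
apply/eqP; rewrite addrC subr_eq0; apply/eqP; apply: eq_bigr => i _.
by rewrite ps_inv_recE ?leq_subr // subSS.
Qed.

End PowerSeries.

Local Open Scope classical_set_scope.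

Section Walks.
Variable S : {fset (int * int)%type}.

(* The position after k steps of the walk from the origin with step list w. *)
Definition walk_pos n (w : n.-tuple S) (k : nat) : (int * int)%type :=
  \sum_(s <- take k w) fsval s.

Definition quadrant_walk n (w : n.-tuple S) : bool :=
  [forall k : 'I_n.+1, in_quadrant (walk_pos w k)].

(* q(i, j; n) for k = (i, j). *)
Definition qwalks (k : (int * int)%type) (n : nat) : nat :=
  #|[pred w : n.-tuple S | quadrant_walk w && (walk_pos w n == k)]|.

(* All (i, j) with a nonzero number of quadrant walks of length n lie in this
   finite set, so sums over (i, j) may be restricted to it. *)
Definition endpoints (n : nat) : {fset (int * int)%type} :=
  [fset walk_pos w n | w in {: n.-tuple S}].

(* The coefficient of t^n in Q(x, y; t), as a Laurent polynomial. *)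
Definition Qgf (n : nat) : laurent :=
  Laurent [malg k in endpoints n => (qwalks k n)%:R].

Lemma qwalks_eq0 k n : k \notin endpoints n -> qwalks k n = 0%N.
Proof.
move=> kn; apply: eq_card0 => w; rewrite !inE; apply/negP => /andP[_ /eqP kE].
by move: kn; rewrite -kE; apply/negP; rewrite negbK; apply/imfsetP; exists w.
Qed.

Lemma QgfE k n : lcoef (Qgf n) k = (qwalks k n)%:R.
Proof. by rewrite /lcoef mcoeffE; case: ifPn => // /qwalks_eq0 ->. Qed.

Definition qtotal (n : nat) : nat := \sum_(k <- endpoints n) qwalks k n.

Definition loop_length (n : nat) : Prop :=
  exists w : n.-tuple S, walk_pos w n = 0.

(* p is the gcd of the lengths of the closed walks, which need not stay in the
   quadrant. *)
Definition is_period (p : nat) : Prop :=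
  (forall n, loop_length n -> p %| n)%N /\
  (forall d, (forall n, loop_length n -> d %| n)%N -> (d %| p)%N).

Definition excursion_exponent (R : realType) (alpha : R) : Prop :=
  exists (p : nat) (mu kappa1 kappa2 : R),
    [/\ is_period p, 0 < mu, 0 < kappa1, 0 < kappa2 &
      \forall n \near \oo, (p %| n)%N ->
        kappa1 * mu ^+ n * n%:R `^ alpha <= (qwalks 0 n)%:R
          <= kappa2 * mu ^+ n * n%:R `^ alpha].

Definition walk_exponent (R : realType) (alpha : R) : Prop :=
  exists (rho : R) (C : nat -> R),
    [/\ 0 < rho, forall n, 0 < C n,
      exists2 d, (0 < d)%N & forall n, C (n + d)%N = C n &
      (fun n => (qtotal n)%:R : R^o) ~_\oo
        (fun n => C n * rho ^+ n * n%:R `^ alpha : R^o)].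

End Walks.

Definition steps : {fset (int * int)%type} :=
  let step (i j : int) : (int * int)%type := (i, j) in
  [fset step 0 1; step 1 (-1); step (-1) (-1); step (-2) 1; step (-1) 0].

(* Main.v *)
From HB Require Import structures.
Require Import Defs.
From mathcomp Require Import all_boot all_order all_algebra finmap.
From mathcomp.multinomials Require Import monalg.
From mathcomp Require Import complex.
From mathcomp Require Import all_classical all_reals all_analysis.
From mathcomp Require Import measurable_realfun.
From mathcomp Require Import ring lra zify.
Set Implicit Arguments. Unset Strict Implicit.
Unset Printing Implicit Defensive.
Import Order.TTheory GRing.Theory Num.Theory.
Import numFieldNormedType.Exports.
Local Open Scope ring_scope.

(** Write S = y + x/y + 1/(xy) + y/x^2 + 1/x for the step polynomial, N for the
    Laurent polynomial multiplying 1/(1 - tS), U = y - x/y, and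
    D_x = x d/dx, D_xy = x d/dx + y d/dy, D_y = y d/dy.

    Exact part.  The three factors of N are, up to monomials, U, D_x S and
    D_xy S, and a computation gives
      D_x D_xy (U S^M) = M (M - 1) x y N S^(M - 2),
    because D_x D_xy U = 0 and the terms with a single derivative falling on S
    cancel (euler_refl_step).  Reading off coefficients,
      (n+1)(n+2) [x^i y^j] N S^n = (i+1)(i+j+2) [x^(i+1) y^(j+1)] U S^(n+2).
    The right-hand side vanishes for i = -1 because of the prefactor, and for
    j = -1 because D_y S = (1 + x^-2) U, which makes b [x^a y^b] S^(m+1) equal
    to (m+1) ([x^a y^b] U S^m + [x^(a+2) y^b] U S^m).  Every point outside the
    quadrant from which a step leads into it lies on one of the lines x = -1 and
    y = -1, so the coefficients of N S^n in the quadrant satisfy the recursion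
    of quadrant walks, with the same initial value (qwalks_weighted).  This is
    the generating function identity.

    Asymptotic part.  Solving the last relation for U, the number of quadrant
    walks ending at (i, j) is, with a = i+1, b = j+1, m = n+3,
      a b (a+b) / (m (m-1) (m-2)) * sum_k (-1)^k [x^(a+2k) y^b] S^m,
    so three of the four powers of n come out exactly, and it remains to see
    that coefficients of S^m are of order mu^m / m.  At the critical point
    (r^2, r) of S, where r^4 = r + 3, the weights of the five steps become the
    law of a centred aperiodic random walk, and the local limit theorem in the
    plane (local_limit) gives the last power: it follows from Fourier inversion
    on a square of side 2 pi sqrt m and dominated convergence.  The uniform
    bound and the positive pointwise limits of the local theorem pass through
    the sums over k, i and j by dominated convergence for series (tannery),
    because the monomials at (r^2, r) decay geometrically.  Hence both q(0,0;n)
    and the total number of walks are equivalent to a positive constant times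
    mu^n n^-4. *)

(** * Laurent polynomials: coefficients and Euler derivations *)

Section LaurentCoefficients.
Implicit Types (f g : laurent) (k l : (int * int)%type).

Lemma lcoefMw (d e : {fset (int * int)%type}) f g k :
  (msupp (lval f) `<=` d)%fset -> (msupp (lval g) `<=` e)%fset ->
  lcoef (f * g) k =
  \sum_(l <- d) \sum_(m <- e) (lcoef f l * lcoef g m) *+ (l + m == k).
Proof.
move=> fd ge; rewrite lmulE /lcoef /= (lmulEw fd ge) raddf_sum.
apply: eq_bigr => l _ /=; rewrite raddf_sum.
by apply: eq_bigr => m _ /=; rewrite mcoeffU.
Qed.

Lemma lcoef0 k : lcoef 0 k = 0.
Proof. exact: mcoeff0. Qed.

Lemma lcoefN f k : lcoef (- f) k = - lcoef f k.
Proof. exact: mcoeffN. Qed.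

Lemma lcoefB f g k : lcoef (f - g) k = lcoef f k - lcoef g k.
Proof. by rewrite lcoefD lcoefN. Qed.

Lemma lcoefMn f n k : lcoef (f *+ n) k = lcoef f k *+ n.
Proof. by elim: n => [|n IH]; rewrite ?mulr0n ?lcoef0 // !mulrS lcoefD IH. Qed.

Lemma lcoef_natl n f k : lcoef (n%:R * f) k = n%:R * lcoef f k.
Proof. by rewrite !mulr_natl lcoefMn. Qed.

Lemma lcoef_lmonoM l f k : lcoef (lmono l * f) k = lcoef f (k - l).
Proof.
rewrite lmulE /lcoef lmono.unlock /= (monalgE (lval f)) lmul_sumr !raddf_sum.
apply: eq_bigr => m _ /=; rewrite lmulUU mul1r !mcoeffU.
by rewrite [l + m]addrC -[in RHS](inj_eq (addIr l)) subrK.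
Qed.

Lemma lmono0 : lmono 0 = 1.
Proof. by []. Qed.

(** The derivation attached to a linear form w on the exponents: x d/dx for
    w(i, j) = i, and y d/dy for w(i, j) = j. *)
Definition euler (w : {additive (int * int)%type -> int}) f : laurent :=
  Laurent [malg k in msupp (lval f) => (w k)%:~R * lcoef f k].

Lemma lcoef_euler w f k : lcoef (euler w f) k = (w k)%:~R * lcoef f k.
Proof.
rewrite {1}/lcoef mcoeffE; case: msuppP => // k0.
by rewrite /lcoef mcoeff_outdom ?mulr0.
Qed.

Lemma eulerD w f g : euler w (f + g) = euler w f + euler w g.
Proof. by apply/lcoefP => k; rewrite !(lcoef_euler, lcoefD) mulrDr. Qed.

Lemma eulerN w f : euler w (- f) = - euler w f.
Proof. by apply/lcoefP => k; rewrite !(lcoef_euler, lcoefN) mulrN. Qed.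

Lemma eulerB w f g : euler w (f - g) = euler w f - euler w g.
Proof. by rewrite eulerD eulerN. Qed.

Lemma euler_mono w k : euler w (lmono k) = (w k)%:~R * lmono k.
Proof.
apply/lcoefP => l; rewrite lcoef_euler lmonoE.
have -> : lcoef ((w k)%:~R * lmono k) l = (w k)%:~R * lcoef (lmono k) l.
  by case: (w k) => n; rewrite ?NegzE ?mulrNz ?mulNr ?lcoefN lcoef_natl.
by rewrite lmonoE; case: eqP => [->|]; rewrite ?mulr0.
Qed.

Lemma eulerM w f g : euler w (f * g) = euler w f * g + f * euler w g.
Proof.
apply/lcoefP => k; rewrite lcoefD lcoef_euler.
have le h : (msupp (lval (euler w h)) `<=` msupp (lval h))%fset.
  apply/fsubsetP => l; rewrite -!mcoeff_neq0 => h0; apply: contra_neq h0 => h0.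
  by rewrite -/(lcoef _ _) lcoef_euler /lcoef h0 mulr0.
rewrite (lcoefMw k (fsubset_refl _) (fsubset_refl _)).
rewrite (lcoefMw k (le f) (fsubset_refl _)) (lcoefMw k (fsubset_refl _) (le g)).
rewrite mulr_sumr -big_split; apply: eq_bigr => l _ /=.
rewrite mulr_sumr -big_split; apply: eq_bigr => m _ /=.
have [<-|] := eqVneq (l + m) k; last by rewrite !mulr0n mulr0 addr0.
by rewrite !lcoef_euler raddfD /= rmorphD /=; ring.
Qed.

Lemma euler1 w : euler w 1 = 0.
Proof. by rewrite -lmono0 euler_mono raddf0 mul0r. Qed.

Lemma eulerX w f n : euler w (f ^+ n.+1) = n.+1%:R * f ^+ n * euler w f.
Proof.
elim: n => [|n IH]; first by rewrite expr0 expr1 !mul1r.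
by rewrite exprS eulerM IH [n.+2%:R]mulrS [f ^+ n.+1]exprS; ring.
Qed.

End LaurentCoefficients.

Definition deg_x (k : (int * int)%type) : int := k.1.
Definition deg_y (k : (int * int)%type) : int := k.2.
Definition deg_xy (k : (int * int)%type) : int := k.1 + k.2.

Fact deg_x_additive : additive deg_x. Proof. by []. Qed.
Fact deg_y_additive : additive deg_y. Proof. by []. Qed.
Fact deg_xy_additive : additive deg_xy.
Proof. by move=> k l; rewrite /deg_xy /=; ring. Qed.

HB.instance Definition _ :=
  GRing.isZmodMorphism.Build (int * int)%type int deg_x deg_x_additive.
HB.instance Definition _ :=
  GRing.isZmodMorphism.Build (int * int)%type int deg_y deg_y_additive.
HB.instance Definition _ :=
  GRing.isZmodMorphism.Build (int * int)%type int deg_xy deg_xy_additive.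

(** * The kernel, its derivatives, and the weight of the walks *)

Section LaurentIdentities.
Variables (A : comNzRingType) (x X y Y : A).
Hypotheses (xK : x * X = 1) (yK : y * Y = 1).

(* Sx, Sxy and Sy are the images of S by x d/dx, by x d/dx + y d/dy and by
   y d/dy, and Sx_xy is the image of Sxy by x d/dx. *)
Let U := y - x * Y.
Let Sx := x * Y - X * Y - 2 * X ^+ 2 * y - X.
Let Sxy := y - 2 * X * Y - X ^+ 2 * y - X.
Let Sx_xy := 2 * X * Y + 2 * X ^+ 2 * y + X.
Let Sy := y - x * Y - X * Y + X ^+ 2 * y.

(** Reduces an identity between Laurent polynomials to one between polynomials
    in x, X, y, Y: c and d are the quotients of a - b by the two relations. *)
Lemma ring_eq_mod (a b c d : A) :
  a - b = c * (x * X - 1) + d * (y * Y - 1) -> a = b.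
Proof.
by rewrite xK yK !subrr !mulr0 addr0 => /eqP; rewrite subr_eq0 => /eqP.
Qed.

(** This explains the numerator: up to monomials its factors are those that
    remain when U S^M is differentiated twice, see euler_refl_step. *)
Lemma numerator_factors :
  (y ^+ 2 - x) * (x ^+ 2 * y ^+ 2 - x * y - y ^+ 2 - 2 * x)
    * (x ^+ 3 - x * y - 2 * y ^+ 2 - x) * (X ^+ 5 * Y ^+ 4)
  = U * Sx * Sxy * (X * Y).
Proof.
have -> : U = (y ^+ 2 - x) * Y.
  by apply: (@ring_eq_mod _ _ 0 (- y)); rewrite /U; ring.
have -> : Sx = (x ^+ 3 - x * y - 2 * y ^+ 2 - x) * (X ^+ 2 * Y).
  apply: (@ring_eq_mod _ _ (X * Y + X * y * Y - x * Y - x ^+ 2 * X * Y)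
                           (X + 2 * X ^+ 2 * y)).
  by rewrite /Sx; ring.
have -> : Sxy
    = (x ^+ 2 * y ^+ 2 - x * y - y ^+ 2 - 2 * x) * (X ^+ 2 * Y).
  apply: (@ring_eq_mod _ _ (- y ^+ 2 * Y + 2 * X * Y + X * y * Y
                            - x * X * y ^+ 2 * Y) (- y + X + X ^+ 2 * y)).
  by rewrite /Sxy; ring.
by ring.
Qed.

(** All monomials but 1 have a negative exponent, so that the walk of length 0
    is the only contribution to the initial values in the quadrant. *)
Lemma numerator_expansion :
  U * Sx * Sxy * (X * Y) =
  1 + Y ^+ 3 + 2 * Y ^+ 4 - X ^+ 2 * Y ^+ 2 - 3 * X ^+ 2 * Y ^+ 3
  - 2 * X ^+ 2 * Y ^+ 4 - X ^+ 2 * y + X ^+ 3 - 3 * X ^+ 3 * Y ^+ 2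
  - 2 * X ^+ 3 * y ^+ 2 + 3 * X ^+ 4 + 3 * X ^+ 4 * y + 2 * X ^+ 5 * y ^+ 2
  - x * Y ^+ 2.
Proof.
apply: (@ring_eq_mod _ _ (Y ^+ 3 + 2 * Y ^+ 4 + y ^+ 2 * Y ^+ 2
  - X ^+ 2 * Y ^+ 2 - 3 * X ^+ 2 * Y ^+ 3 - 2 * X ^+ 2 * Y ^+ 4
  + X ^+ 2 * y ^+ 2 * Y ^+ 2 - 3 * X ^+ 3 * y * Y ^+ 2
  - 5 * X ^+ 3 * y * Y ^+ 3 - 2 * X ^+ 4 * y ^+ 2 * Y ^+ 2 - x * y * Y ^+ 3
  + x * X * Y ^+ 3 + 2 * x * X * Y ^+ 4 + x * X ^+ 2 * y * Y ^+ 3)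
  (1 + y * Y - X ^+ 2 * y + X ^+ 3 - 3 * X ^+ 3 * Y ^+ 2
  - 2 * X ^+ 3 * y ^+ 2 + 3 * X ^+ 4 + 3 * X ^+ 4 * y + 3 * X ^+ 4 * y * Y
  + 2 * X ^+ 5 * y ^+ 2 - x * Y ^+ 2)).
by rewrite /U /Sx /Sxy; ring.
Qed.

Lemma cross_terms_cancel : - (x * Y) * Sxy + y * Sx + U * Sx_xy = 0.
Proof.
apply: (@ring_eq_mod _ _ (- (X * y * Y)) 0).
by rewrite /U /Sx /Sxy /Sx_xy; ring.
Qed.

Lemma Sy_factor : Sy = (1 + X ^+ 2) * U.
Proof. by apply: (@ring_eq_mod _ _ (X * Y) 0); rewrite /Sy /U; ring. Qed.

End LaurentIdentities.

Definition step_poly : laurent :=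
  ly + lx * lyV + lxV * lyV + lxV ^+ 2 * ly + lxV.

(** U = y - x/y is antisymmetric under y -> x/y, a symmetry of S. *)
Definition refl_poly : laurent := ly - lx * lyV.

Definition walk_weight : laurent :=
  (ly ^+ 2 - lx) * (lx ^+ 2 * ly ^+ 2 - lx * ly - ly ^+ 2 - 2 * lx)
  * (lx ^+ 3 - lx * ly - 2 * ly ^+ 2 - lx) * (lxV ^+ 5 * lyV ^+ 4).

Section KernelDerivatives.
Implicit Types w : {additive (int * int)%type -> int}.

Let gens_x : (euler deg_x lx = lx) *
  (euler deg_x ly = 0) *
  (euler deg_x lxV = - lxV) *
  (euler deg_x lyV = 0).
Proof.
by do !split; rewrite euler_mono /deg_x /= ?mulN1r ?mul1r ?mul0r.
Qed.

Let gens_y : (euler deg_y lx = 0) *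
  (euler deg_y ly = ly) *
  (euler deg_y lxV = 0) *
  (euler deg_y lyV = - lyV).
Proof.
by do !split; rewrite euler_mono /deg_y /= ?mulN1r ?mul1r ?mul0r.
Qed.

Let gens_xy : (euler deg_xy lx = lx) *
  (euler deg_xy ly = ly) *
  (euler deg_xy lxV = - lxV) *
  (euler deg_xy lyV = - lyV).
Proof.
by do !split; rewrite euler_mono /deg_xy /= ?mulN1r ?mul1r ?mul0r.
Qed.

Let euler_sqr w f : euler w (f ^+ 2) = 2 * f * euler w f.
Proof. exact: eulerX. Qed.

Lemma euler_x_step : euler deg_x step_poly =
  lx * lyV - lxV * lyV - 2 * lxV ^+ 2 * ly - lxV.
Proof.
by rewrite /step_poly !(eulerD, eulerM, euler_sqr, gens_x); ring.
Qed.

Lemma euler_xy_step : euler deg_xy step_poly =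
  ly - 2 * lxV * lyV - lxV ^+ 2 * ly - lxV.
Proof.
by rewrite /step_poly !(eulerD, eulerM, euler_sqr, gens_xy); ring.
Qed.

Lemma euler_y_step : euler deg_y step_poly =
  ly - lx * lyV - lxV * lyV + lxV ^+ 2 * ly.
Proof.
by rewrite /step_poly !(eulerD, eulerM, euler_sqr, gens_y); ring.
Qed.

Lemma euler_x_xy_step : euler deg_x (euler deg_xy step_poly) =
  2 * lxV * lyV + 2 * lxV ^+ 2 * ly + lxV.
Proof.
have e2 : euler deg_x 2 = 0 by rewrite -[2]/(1 + 1) eulerD euler1 addr0.
rewrite euler_xy_step.
by rewrite !(eulerD, eulerN, eulerM, euler_sqr, gens_x, e2); ring.
Qed.

Lemma euler_x_refl : euler deg_x refl_poly = - (lx * lyV).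
Proof.
by rewrite /refl_poly !(eulerB, eulerM, gens_x); ring.
Qed.

Lemma euler_xy_refl : euler deg_xy refl_poly = ly.
Proof.
by rewrite /refl_poly !(eulerB, eulerM, gens_xy); ring.
Qed.

(** With D1 = x d/dx, D2 = x d/dx + y d/dy and M = n + 2, the product rule
    yields D1 D2 U, which vanishes, terms with a single factor M, which cancel,
    and M (M - 1) U (D1 S) (D2 S) S^(M - 2), which contains the numerator. *)
Lemma euler_refl_step n :
  euler deg_x (euler deg_xy (refl_poly * step_poly ^+ n.+2)) =
  (n.+1%:R * n.+2%:R) * (lmono (1, 1) * (walk_weight * step_poly ^+ n)).
Proof.
have e_nat m : euler deg_x m%:R = 0.
  apply/lcoefP => k; rewrite lcoef_euler -[m%:R]mulr1 lcoef_natl lcoef0.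
  by rewrite -lmono0 lmonoE; case: eqP => [<-|]; rewrite ?mulr0 ?mul0r.
have -> : walk_weight = refl_poly * euler deg_x step_poly
    * euler deg_xy step_poly * lmono (-1, -1).
  rewrite euler_x_step euler_xy_step -[(-1, -1)]/((-1, 0) + (0, -1)) lmonoD.
  exact: (numerator_factors lxK lyK).
have mK : lmono (1, 1) * lmono (-1, -1) = 1 by rewrite -lmonoD.
have cross := cross_terms_cancel lxK lyK.
rewrite -euler_x_step -euler_xy_step -euler_x_xy_step in cross.
rewrite eulerM euler_xy_refl eulerX eulerD (eulerM _ ly) eulerX gens_x.
rewrite (eulerM _ refl_poly) euler_x_refl (eulerM _ _ (euler deg_xy step_poly)).
rewrite (eulerM _ n.+2%:R) eulerX e_nat.
set a := euler deg_x step_poly in cross *.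
set b := euler deg_xy step_poly in cross *.
set c := euler deg_x b in cross *.
apply/eqP; rewrite -subr_eq0; apply/eqP.
transitivity (n.+2%:R * step_poly ^+ n.+1 *
    (- (lx * lyV) * b + ly * a + refl_poly * c)
  + n.+1%:R * n.+2%:R * refl_poly * a * b * step_poly ^+ n *
    (1 - lmono (1, 1) * lmono (-1, -1))).
  by ring.
by rewrite cross mK subrr !mulr0 addr0.
Qed.

(** Since U divides y dS/dy, coefficients of U S^n can be expressed through
    those of S^(n + 1). *)
Lemma euler_y_step_pow n : euler deg_y (step_poly ^+ n.+1) =
  n.+1%:R * ((1 + lxV ^+ 2) * (refl_poly * step_poly ^+ n)).
Proof.
by rewrite eulerX euler_y_step (Sy_factor lxK lyK) -/refl_poly; ring.
Qed.

End KernelDerivatives.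

(** * Quadrant walks and their generating function *)

Section QuadrantRecursion.
Variable S : {fset (int * int)%type}.
Implicit Types (s : S) (k : (int * int)%type).

Lemma walk_pos_rcons n (w : n.-tuple S) s j :
  walk_pos [tuple of rcons w s] j =
  if (j <= n)%N then walk_pos w j else walk_pos w n + fsval s.
Proof.
rewrite /walk_pos /= -cats1 take_cat size_tuple.
case: (ltngtP j n) => [//|jn|->].
  rewrite [take _ [:: s]]take_oversize ?subn_gt0 // big_cat big_seq1 /=.
  by rewrite (@take_oversize _ n) ?size_tuple.
by rewrite subnn take0 cats0 take_oversize ?size_tuple.
Qed.

Lemma quadrant_walk_rcons n (w : n.-tuple S) s :
  quadrant_walk [tuple of rcons w s] =
  quadrant_walk w && in_quadrant (walk_pos w n + fsval s).
Proof.
apply/forallP/andP => [q|[/forallP q qs] j].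
  split; last by have := q ord_max; rewrite walk_pos_rcons ltnn.
  apply/forallP => j; have := q (widen_ord (leqnSn _) j).
  by rewrite walk_pos_rcons /= -ltnS ltn_ord.
rewrite walk_pos_rcons; case: leqP => // jn.
by have := q (Ordinal (n:=n.+1) (m:=j) jn).
Qed.

Lemma qwalks0 k : qwalks S k 0 = (k == 0).
Proof.
have pos0 (w : 0.-tuple S) j : walk_pos w j = 0.
  by rewrite tuple0 /walk_pos big_nil.
have quad0 (w : 0.-tuple S) : quadrant_walk w.
  by apply/forallP => j; rewrite pos0.
rewrite /qwalks; have [->|k0] := eqVneq k 0.
  rewrite -[RHS](card_tuple 0 S) /=; apply: eq_card => w.
  by rewrite !inE quad0 pos0 eqxx.
by apply: eq_card0 => w; rewrite !inE quad0 pos0 eq_sym (negbTE k0).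
Qed.

(** The map h below splits off the last step of a walk. *)
Lemma qwalksS k n : qwalks S k n.+1 =
  if in_quadrant k then (\sum_(s <- S) qwalks S (k - s)%R n)%N else 0%N.
Proof.
rewrite big_seq_fsetE /=.
pose h (p : S * n.-tuple S) := [tuple of rcons p.2 p.1].
have hbij : {on [pred w | quadrant_walk w && (walk_pos w n.+1 == k)],
             bijective h}.
  apply: onW_bij; exists (fun w : n.+1.-tuple S =>
    (last (thead w) w, [tuple of belast (thead w) (behead w)])).
    case=> s w; congr pair; rewrite /h /=; last apply: val_inj => /=.
      by rewrite last_rcons.
    by case: w => -[|a w] //= sw; rewrite /thead (tnth_nth s) /= belast_rcons.
  case/tupleP => a w; apply: val_inj; rewrite /h /= theadE /=.
  by rewrite -lastI.
rewrite /qwalks -sum1_card (reindex _ hbij) /=.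
have hE p : quadrant_walk (h p) && (walk_pos (h p) n.+1 == k) =
    quadrant_walk p.2 && in_quadrant (walk_pos p.2 n + fsval p.1)
    && (walk_pos p.2 n + fsval p.1 == k).
  by rewrite quadrant_walk_rcons walk_pos_rcons ltnn.
rewrite (eq_bigl _ _ hE).
rewrite -(pair_big_dep xpredT (fun s (w : n.-tuple S) =>
  quadrant_walk w && in_quadrant (walk_pos w n + fsval s)
  && (walk_pos w n + fsval s == k)) (fun _ _ => 1%N)) /=.
have [kq|kq] := ifPn; last first.
  rewrite big1 // => s _; rewrite big_pred0 // => w.
  case: eqP => [->|_]; last by rewrite andbF.
  by rewrite (negbTE kq) !andbF.
apply: eq_bigr => s _; rewrite -sum1_card; apply: eq_bigl => w.
rewrite !inE [_ == _ - _]eq_sym subr_eq [k == _]eq_sym.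
by case: eqP => [->|_]; rewrite ?kq ?andbF // !andbT.
Qed.

End QuadrantRecursion.

Lemma big_steps (V : nmodType) (F : (int * int)%type -> V) :
  \sum_(s <- steps) F s =
  F (0, 1) + F (1, -1) + F (-1, -1) + F (-2, 1) + F (-1, 0).
Proof.
rewrite /steps; do 4!(rewrite fsetUC big_fsetU1 /= ?inE //).
by rewrite big_seq_fset1 addrC; congr (_ + _); rewrite addrC; congr (_ + _);
  rewrite addrC; congr (_ + _); rewrite addrC.
Qed.

(** * The coefficients of the weighted series *)

Notation free_coef m k := (lcoef (step_poly ^+ m) k).
Notation refl_coef m k := (lcoef (refl_poly * step_poly ^+ m) k).
Notation weighted_coef n k := (lcoef (walk_weight * step_poly ^+ n) k).

Lemma step_polyE : step_poly = \sum_(s <- steps) lmono s.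
Proof. by rewrite big_steps /step_poly expr2 -!lmonoD. Qed.

Lemma lcoef_step f k :
  lcoef (step_poly * f) k = \sum_(s <- steps) lcoef f (k - s).
Proof.
rewrite step_polyE mulr_suml (big_morph (fun g => lcoef g k)
  (fun g h => lcoefD g h k) (lcoef0 k)).
by apply: eq_bigr => s _; rewrite lcoef_lmonoM.
Qed.

Lemma free_coefS m k :
  free_coef m.+1 k = \sum_(s <- steps) free_coef m (k - s).
Proof. by rewrite exprS lcoef_step. Qed.

Lemma refl_coefE m (i j : int) :
  refl_coef m (i, j) = free_coef m (i, j - 1) - free_coef m (i - 1, j + 1).
Proof.
rewrite /refl_poly -lmonoD mulrBl lcoefB !lcoef_lmonoM.
by congr (lcoef _ (_, _) - lcoef _ (_, _)); rewrite /=; ring.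
Qed.

Lemma free_coef_eq0 m (i j : int) :
  (m%:Z < i) || (m%:Z < j) -> free_coef m (i, j) = 0.
Proof.
elim: m i j => [|m IH] i j ij.
  rewrite expr0 -lmono0 lmonoE; case: eqP => // -[i0 j0].
  by move: ij; rewrite -i0 -j0 ltxx.
rewrite free_coefS big_seq big1 // => s.
rewrite !inE -!orbA => /or4P[|||/orP[]] /eqP -> /=;
  by apply: IH; move: ij => /=; lia.
Qed.

Lemma refl_coef_eq0 m (i j : int) : m.+1%:Z < i -> refl_coef m (i, j) = 0.
Proof.
by move=> mi; rewrite refl_coefE !free_coef_eq0 ?subrr //; move: mi; lia.
Qed.

(** This is euler_refl_step read at x^(i+1) y^(j+1), where the two derivations
    act by multiplication by i + 1 and i + j + 2. *)
Lemma weighted_coefE n (i j : int) :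
  (n.+1%:R * n.+2%:R) * weighted_coef n (i, j) =
  (i + 1)%:~R * (i + j + 2)%:~R * refl_coef n.+2 (i + 1, j + 1).
Proof.
have := congr1 (fun f => lcoef f (i + 1, j + 1)) (euler_refl_step n).
rewrite !lcoef_euler -mulrA !lcoef_natl lcoef_lmonoM.
have -> : (i + 1, j + 1) - (1, 1) = (i, j) :> (int * int).
  by congr pair; rewrite /= ?addrK.
rewrite -mulrA => <-; rewrite mulrA; congr (_ * _%:~R * _).
by rewrite [LHS]/(i + 1 + (j + 1)) addrACA.
Qed.

Lemma free_refl_coef m (i j : int) :
  j%:~R * free_coef m.+1 (i, j) =
  m.+1%:R * (refl_coef m (i, j) + refl_coef m (i + 2, j)).
Proof.
have := congr1 (fun f => lcoef f (i, j)) (euler_y_step_pow m).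
rewrite lcoef_euler lcoef_natl => ->; congr (_ * _).
rewrite mulrDl mul1r lcoefD expr2 -lmonoD lcoef_lmonoM.
by congr (_ + lcoef _ (_, _)); rewrite /=; ring.
Qed.

(** For j = 0 the left-hand side of free_refl_coef vanishes, so the coefficient
    only changes its sign from i to i + 2, and it is zero for large i. *)
Lemma refl_coef_axis m (i : int) : refl_coef m (i, 0) = 0.
Proof.
have [d id] : exists d : nat, m.+1%:Z < i + d.*2%:Z.
  by exists (m.+2 + `|i|)%N; lia.
elim: d i id => [|d IH] i id; first by rewrite refl_coef_eq0 //; lia.
have := free_refl_coef m i 0; rewrite mul0r => /esym /eqP.
rewrite mulf_eq0 pnatr_eq0 /= (IH (i + 2)) ?addr0; last by lia.
by move=> /eqP.
Qed.

(** As no step increases a coordinate by more than 1, these two lines contain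
    all points outside the quadrant from which a step leads into it. *)
Lemma weighted_coef_boundary n k :
  (k.1 == -1) || (k.2 == -1) -> weighted_coef n k = 0.
Proof.
case: k => i j /= ij; have n0 : (n.+1%:R * n.+2%:R : rat) != 0.
  by rewrite mulf_neq0 ?pnatr_eq0.
apply: (mulfI n0); rewrite weighted_coefE mulr0.
case/orP: ij => /eqP ->; first by rewrite addNr !mul0r.
by rewrite addNr refl_coef_axis mulr0.
Qed.

Lemma weighted_coef0 k :
  in_quadrant k -> weighted_coef 0 k = (k == 0)%:R.
Proof.
rewrite expr0 mulr1 /walk_weight (numerator_factors lxK lyK).
rewrite (numerator_expansion lxK lyK).
have mX m l : lmono l ^+ m.+1 = lmono (l *+ m.+1).
  elim: m => [|m IH]; first by rewrite expr1.
  by rewrite exprS IH -lmonoD [in RHS]mulrS.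
rewrite !mX -!mulrA -!lmonoD -lmono0.
rewrite !(lcoefD, lcoefN, lcoef_natl, lmonoE).
case: k => i j; rewrite /in_quadrant /= => /andP[i0 j0].
rewrite eq_sym.
have off (a b : int) : (a < 0) || (b < 0) -> ((a, b) == (i, j)) = false.
  by move=> ab; apply/eqP => -[ai bj]; move: ab; rewrite ai bj; lia.
by rewrite !off // ?mulr0 ?addr0 ?subr0 ?oppr0 ?addr0.
Qed.

Lemma weighted_coefS n k :
  weighted_coef n.+1 k = \sum_(s <- steps) weighted_coef n (k - s).
Proof. by rewrite exprS mulrCA lcoef_step. Qed.

(** In the quadrant both sides satisfy the same recursion, because the terms
    that the free recursion takes from outside the quadrant vanish. *)
Theorem qwalks_weighted n k : in_quadrant k ->
  (qwalks steps k n)%:R = weighted_coef n k.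
Proof.
elim: n k => [|n IH] k kq; first by rewrite qwalks0 weighted_coef0.
rewrite qwalksS kq natr_sum weighted_coefS.
rewrite big_seq [RHS]big_seq; apply: eq_bigr => s sS.
have [ksq|ksq] := boolP (in_quadrant (k - s)); first exact: IH.
rewrite weighted_coef_boundary.
  by case: (n) => [|m]; rewrite ?qwalks0 ?qwalksS ?(negbTE ksq) //;
    case: eqP ksq => // ->.
move: sS ksq kq; case: k => i j; rewrite /in_quadrant !inE -!orbA.
by move=> /or4P[|||/orP[]] /eqP -> /=; lia.
Qed.

(** * The generating function identity *)

Lemma ps_mul_const (A : comNzRingType) (a : A) (F : nat -> A) n :
  ps_mul (ps_const a) F n = a * F n.
Proof.
rewrite /ps_mul big_ord_recl subn0 big1 ?addr0 // => i _.
by rewrite /ps_const /= mul0r.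
Qed.

Lemma ps_inv_geometric (A : comNzRingType) (a : A) n :
  ps_inv (ps_sub (ps_const 1) (ps_mul (ps_t A) (ps_const a))) n = a ^+ n.
Proof.
set F := ps_sub _ _.
have tE m : ps_mul (ps_t A) (ps_const a) m = (m == 1)%:R * a.
  rewrite /ps_mul /ps_t; case: m => [|[|m]].
  - by rewrite big_ord1 !mul0r.
  - by rewrite !big_ord_recl big_ord0 /= mul0r add0r addr0.
  rewrite !big_ord_recl big1 /= ?mul0r ?add0r ?addr0 => [|i _].
    by rewrite /ps_const /= mulr0.
  by rewrite mul0r.
have F0 : F 0%N = 1 by rewrite /F /ps_sub tE /= mul0r subr0.
have F1 : F 1%N = - a by rewrite /F /ps_sub tE /= mul1r sub0r.
have F2 m : F m.+2 = 0 by rewrite /F /ps_sub tE /= mul0r subr0.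
elim: n => [|n IH]; first by [].
have := ps_mulV F0 n.+1; rewrite /ps_mul !big_ord_recl F0 mul1r subn0.
rewrite big1 => [|i _]; last by rewrite [X in F X]/= F2 mul0r.
rewrite [X in F X]/= F1 subSS subn0 addr0 IH exprS mulNr => /eqP.
by rewrite subr_eq0 => /eqP.
Qed.

Lemma Qgf_weighted n :
  Qgf steps n = nonneg_part (walk_weight * step_poly ^+ n).
Proof.
apply/lcoefP => k; rewrite QgfE nonneg_partE.
have [kq|kq] := ifPn; first exact: qwalks_weighted.
case: n => [|n]; rewrite ?qwalks0 ?qwalksS ?(negbTE kq) //.
by case: eqP kq => // ->.
Qed.

(** * Complex exponentials *)

Section Characters.
Variable R : realType.
Implicit Types (t x : R) (z w : R[i]).
Local Open Scope complex_scope.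

Local Notation normc := (@ComplexField.Normc.normc R).
Local Notation Re := (@complex.Re R).
Local Notation Im := (@complex.Im R).

Definition cis t : R[i] := cos t +i* sin t.

Lemma cisD t x : cis (t + x) = cis t * cis x.
Proof.
by rewrite /cis cosD sinD; simpc; rewrite [sin t * _ + _]addrC.
Qed.

Lemma normc_cis t : normc (cis t) = 1.
Proof. by rewrite /= cos2Dsin2 sqrtr1. Qed.

Lemma normcX z n : normc (z ^+ n) = normc z ^+ n.
Proof.
elim: n => [|n IH]; first exact: ComplexField.Normc.normc1.
by rewrite !exprS ComplexField.Normc.normcM IH.
Qed.

Lemma normc_real x : normc x%:C = `|x|.
Proof. by rewrite /= expr0n /= addr0 sqrtr_sqr. Qed.

Lemma Re_le_normc z : `|Re z| <= normc z.
Proof.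
case: z => a b /=; rewrite -sqrtr_sqr ler_wsqrtr // lerDl sqr_ge0 //.
Qed.

Lemma normc_ge0 z : 0 <= normc z.
Proof. by case: z => a b /=; rewrite sqrtr_ge0. Qed.

Lemma normc_le_ReIm z : normc z <= `|Re z| + `|Im z|.
Proof.
case: z => a b /=; rewrite -[leRHS]ger0_norm ?addr_ge0 //.
rewrite -sqrtr_sqr ler_wsqrtr // sqrrD !real_normK ?num_real //.
by rewrite addrAC lerDl mulrn_wge0 // mulr_ge0.
Qed.

Lemma normc_sqr z : normc z ^+ 2 = Re z ^+ 2 + Im z ^+ 2.
Proof. by case: z => a b /=; rewrite sqr_sqrtr // addr_ge0 // sqr_ge0. Qed.

Lemma normc_expr_sub z w n : normc z <= 1 -> normc w <= 1 ->
  normc (z ^+ n - w ^+ n) <= n%:R * normc (z - w).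
Proof.
move=> z1 w1; elim: n => [|n IH].
  by rewrite subrr ComplexField.Normc.normc0 mul0r.
have -> : z ^+ n.+1 - w ^+ n.+1 = z * (z ^+ n - w ^+ n) + (z - w) * w ^+ n.
  by rewrite !exprS; ring.
apply: le_trans (le_normcD _ _) _.
rewrite !ComplexField.Normc.normcM -natr1 mulrDl mul1r lerD //.
  by apply: le_trans IH; rewrite ler_piMl ?normc_ge0.
by rewrite ler_piMr ?normc_ge0 // normcX exprn_ile1 ?normc_ge0.
Qed.

Lemma Re_sum I (r : seq I) (F : I -> R[i]) :
  Re (\sum_(i <- r) F i) = \sum_(i <- r) Re (F i).
Proof. by apply: (big_morph Re) => [[a b] [c d]|]. Qed.

Lemma Im_sum I (r : seq I) (F : I -> R[i]) :
  Im (\sum_(i <- r) F i) = \sum_(i <- r) Im (F i).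
Proof. by apply: (big_morph Im) => [[a b] [c d]|]. Qed.

Lemma ReZ x z : Re (x%:C * z) = x * Re z.
Proof. by case: z => a b; simpc. Qed.

Lemma ImZ x z : Im (x%:C * z) = x * Im z.
Proof. by case: z => a b; simpc. Qed.

End Characters.

(** * Elementary bounds for sine, cosine and the exponential *)

Section TrigBounds.
Variable R : realType.
Implicit Types t x : R.

Lemma MVT0 (f df : R -> R) x :
  0 <= x -> (forall y : R, is_derive y 1 f (df y)) ->
  exists2 c, 0 <= c <= x & f x - f 0 = df c * x.
Proof.
move=> x0 fdf.
have fd (y : R) : y \in `]0, x[ -> is_derive y 1 f (df y) by move=> _.
have [|c] := MVT_segment x0 fd; last by rewrite in_itv /= subr0; exists c.
apply: continuous_subspaceT => y; apply: differentiable_continuous.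
by apply/derivable1_diffP; exact: ex_derive.
Qed.

Lemma sin_lex x : 0 <= x -> sin x <= x.
Proof.
move=> x0; have [c _] := @MVT0 (fun y => y - sin y) (fun y => 1 - cos y) x x0 _.
rewrite /= sin0 !subr0 => xE; rewrite -subr_ge0 xE.
by rewrite mulr_ge0 // subr_ge0 cos_le1.
Qed.

Lemma xcosx_le_sin x : 0 <= x <= pi -> x * cos x <= sin x.
Proof.
move=> /andP[x0 xpi].
have fd (y : R) : is_derive y 1 (fun y => sin y - y * cos y) (y * sin y).
  have -> : y * sin y = cos y - (y * (- sin y) + cos y * 1) by ring.
  by apply: is_deriveB; apply: is_deriveM.
have [c /andP[c0 cx]] := MVT0 x0 fd.
rewrite sin0 !mul0r !subr0 => xE; rewrite -subr_ge0 xE.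
by rewrite !mulr_ge0 // sin_ge0_pi // c0 (le_trans cx).
Qed.

Lemma one_sub_cos t : 1 - cos t = 2 * sin (t / 2) ^+ 2.
Proof.
rewrite {1}[t](_ : _ = (t / 2) *+ 2); last by rewrite mulr2n -splitr.
by rewrite cos_mulr2n cos2sin2; ring.
Qed.

Lemma norm_sin_le t : `|sin t| <= `|t|.
Proof.
wlog t0 : t / 0 <= t.
  move=> H; have [/H//|/ltW t0] := leP 0 t.
  by rewrite -[in leRHS]normrN -[in leLHS]normrN -sinN H // oppr_ge0.
have [|] := leP 0 (sin t); first by move=> ?; rewrite !ger0_norm // sin_lex.
have [tpi|pit _] := leP t pi; first by rewrite ltNge sin_ge0_pi ?t0.
by rewrite (le_trans (sin_max t)) // ger0_norm // (le_trans _ (ltW pit)) //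
  (le_trans _ (@pi_ge2 R)) // ler1n.
Qed.

Lemma one_sub_cos_le t : 1 - cos t <= t ^+ 2 / 2.
Proof.
rewrite one_sub_cos -[sin _ ^+ 2]real_normK ?num_real //.
have := norm_sin_le (t / 2); rewrite -(@ler_pXn2r _ 2) ?nnegrE //.
rewrite [X in _ <= X]real_normK ?num_real //; lra.
Qed.

Lemma sin_sub_le t : `|t| <= 1 -> `|t - sin t| <= `|t| ^+ 3 / 2.
Proof.
wlog t0 : t / 0 <= t.
  move=> H; have [/H//|/ltW t0] := leP 0 t.
  by have := H (- t); rewrite oppr_ge0 sinN -opprD !normrN => /(_ t0).
rewrite !ger0_norm ?subr_ge0 ?sin_lex // => t1.
have := @xcosx_le_sin t; have := one_sub_cos_le t.
have -> : 0 <= t <= pi.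
  by rewrite t0 (le_trans t1) // (le_trans _ (@pi_ge2 R)) // ler1n.
move=> c1 /(_ isT) s1; apply: (@le_trans _ _ (t * (1 - cos t))).
  by rewrite mulrBr mulr1 lerD2l lerN2.
apply: (le_trans (ler_wpM2l t0 c1)); lra.
Qed.

Lemma cos_expansion t : `|t| <= 1 ->
  `|cos t - (1 - t ^+ 2 / 2)| <= `|t| ^+ 3 / 2.
Proof.
move=> t1; have t2 : `|t / 2| <= 1.
  by rewrite normrM (@ger0_norm _ 2^-1) ?invr_ge0 //; lra.
have -> : cos t - (1 - t ^+ 2 / 2) =
    2 * (t / 2 - sin (t / 2)) * (t / 2 + sin (t / 2)).
  by have := one_sub_cos t; nra.
rewrite 2!normrM (@ger0_norm _ 2) //.
have := sin_sub_le t2; have := norm_sin_le (t / 2).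
have := ler_normD (t / 2) (sin (t / 2)).
set a := `|t / 2 + _|; set b := `|t / 2 - _|; set c := `|sin _|.
have -> : `|t / 2| = `|t| / 2 by rewrite normrM (@ger0_norm _ 2^-1) ?invr_ge0.
have a0 : 0 <= a := normr_ge0 _; have b0 : 0 <= b := normr_ge0 _.
set d := `|t| in t1 *.
have d0 : 0 <= d := normr_ge0 _.
move=> h1 h2 h3; have a1 : a <= d by lra.
have b1 : b <= d ^+ 3 / 16 by nra.
have : b * a <= d ^+ 3 / 16 * 1 by apply: ler_pM => //; lra.
have : 0 <= d ^+ 3 by rewrite exprn_ge0.
rewrite -mulrA; lra.
Qed.

(** With sin (t/2) = 2 sin (t/4) cos (t/4) >= (t/2) cos (t/4)^2 and
    cos (t/4)^2 >= 1/2. *)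
Lemma cos_le_quadratic t : `|t| <= pi -> t ^+ 2 / 8 <= 1 - cos t.
Proof.
wlog t0 : t / 0 <= t.
  move=> H; have [/H//|/ltW t0] := leP 0 t.
  by have := H (- t); rewrite oppr_ge0 cosN sqrrN normrN => /(_ t0).
rewrite ger0_norm // => tpi; rewrite one_sub_cos.
have h0 : 0 <= t / 4 by lra.
have hpi : t / 4 <= pi / 4 by lra.
have pi0 : 0 <= pi :> R by exact: pi_ge0.
have c0 : 0 <= cos (t / 2).
  by apply: cos_ge0_pihalf; apply/andP; split; lra.
have c1 : 0 <= cos (t / 4).
  by apply: cos_ge0_pihalf; apply/andP; split; lra.
have t4E : t / 2 = (t / 4) *+ 2 by lra.
have c2 : 1 <= 2 * cos (t / 4) ^+ 2.
  by move: c0; rewrite t4E cos_mulr2n mulr2n; lra.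
have s1 : t / 4 * cos (t / 4) <= sin (t / 4).
  by apply: xcosx_le_sin; apply/andP; split; lra.
have : t / 4 <= sin (t / 2).
  rewrite t4E sin_mulr2n mulr2n.
  have : cos (t / 4) * (t / 4 * cos (t / 4)) <= cos (t / 4) * sin (t / 4).
    exact: ler_wpM2l.
  have : t / 4 * 1 <= t / 4 * (2 * cos (t / 4) ^+ 2) by apply: ler_wpM2l.
  lra.
rewrite -(@ler_pXn2r _ 2) ?nnegrE //; first by lra.
by apply: sin_ge0_pi; apply/andP; split; lra.
Qed.

Lemma expRN_expansion x : 0 <= x -> `|expR (- x) - (1 - x)| <= x ^+ 2.
Proof.
move=> x0; have e1 := expR_ge1Dx (- x); rewrite ger0_norm ?subr_ge0 //.
have x1 : 0 < 1 + x by lra.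
have : expR (- x) <= (1 + x)^-1.
  by rewrite expRN lef_pV2 ?posrE ?expR_gt0 // expR_ge1Dx.
have : (1 + x)^-1 <= 1 - x + x ^+ 2.
  rewrite -[leLHS]mul1r ler_pdivrMr //.
  have : 0 <= x ^+ 3 by rewrite exprn_ge0.
  lra.
lra.
Qed.

End TrigBounds.

(** * Characteristic functions of steps in the plane *)

Section CharacteristicFunction.
Variables (R : realType) (S : seq (int * int)) (p : (int * int)%type -> R).
Hypothesis p_ge0 : forall s, 0 <= p s.
Hypothesis p_sum : \sum_(s <- S) p s = 1.
Implicit Types (k s : (int * int)%type) (u : R * R).
Local Open Scope complex_scope.

Local Notation normc := (@ComplexField.Normc.normc R).
Local Notation Re := (@complex.Re R).
Local Notation Im := (@complex.Im R).

Definition dotp k u : R := k.1%:~R * u.1 + k.2%:~R * u.2.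

Definition charf u : R[i] := \sum_(s <- S) (p s)%:C * cis (dotp s u).

Definition covar u : R := \sum_(s <- S) p s * dotp s u ^+ 2.

Lemma dotpB k s u : dotp (k - s) u = dotp k u - dotp s u.
Proof. by rewrite /dotp !rmorphB /=; ring. Qed.

Lemma dotpZ k (b : R) u : dotp k (b * u.1, b * u.2) = b * dotp k u.
Proof. by rewrite /dotp /=; ring. Qed.

Lemma covar_ge0 u : 0 <= covar u.
Proof. by apply: sumr_ge0 => s _; rewrite mulr_ge0 // sqr_ge0. Qed.

Lemma covarZ (b : R) u : covar (b * u.1, b * u.2) = b ^+ 2 * covar u.
Proof.
by rewrite /covar mulr_sumr; apply: eq_bigr => s _; rewrite dotpZ; ring.
Qed.

Lemma Re_charf u : Re (charf u) = \sum_(s <- S) p s * cos (dotp s u).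
Proof. by rewrite /charf Re_sum; apply: eq_bigr => s _; rewrite ReZ. Qed.

Lemma Im_charf u : Im (charf u) = \sum_(s <- S) p s * sin (dotp s u).
Proof. by rewrite /charf Im_sum; apply: eq_bigr => s _; rewrite ImZ. Qed.

Lemma charf_le1 u : normc (charf u) <= 1.
Proof.
rewrite /charf -p_sum; elim/big_ind2: _ => [|z a w b za wb|s _].
- by rewrite ComplexField.Normc.normc0.
- by apply: le_trans (le_normcD _ _) _; rewrite lerD.
by rewrite ComplexField.Normc.normcM normc_cis mulr1 normc_real ger0_norm.
Qed.

(** All summands are nonnegative, so that a few differences of steps are enough
    to bound the modulus of the characteristic function away from 1. *)
Lemma one_sub_charf_sqr u : 1 - normc (charf u) ^+ 2 =
  \sum_(s <- S) \sum_(r <- S) p s * p r * (1 - cos (dotp (s - r) u)).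
Proof.
rewrite normc_sqr Re_charf Im_charf !expr2 !big_distrlr /= -[X in X - _]mulr1.
rewrite -{1 2}p_sum big_distrlr /= -big_split -sumrB /=.
apply: eq_bigr => s _; rewrite -big_split -sumrB /=.
by apply: eq_bigr => r _; rewrite dotpB cosB; ring.
Qed.

Hypothesis p_mean : forall u, \sum_(s <- S) p s * dotp s u = 0.

(** The linear terms of the sines add up to zero because the steps are centred,
    which is why the error is of third order. *)
Lemma charf_gauss u : {in S, forall s, `|dotp s u| <= 1} ->
  normc (charf u - (expR (- (covar u / 2)))%:C) <=
  \sum_(s <- S) p s * `|dotp s u| ^+ 3 + covar u ^+ 2 / 4.
Proof.
move=> u1; apply: le_trans (normc_le_ReIm _) _; rewrite !raddfB /= subr0.
have q0 : 0 <= covar u / 2 by rewrite divr_ge0 ?covar_ge0.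
have eE := expRN_expansion q0; set e := expR _ in eE *.
have ReE : `|Re (charf u) - (1 - covar u / 2)| <=
    (\sum_(s <- S) p s * `|dotp s u| ^+ 3) / 2.
  have -> : Re (charf u) - (1 - covar u / 2) =
      \sum_(s <- S) p s * (cos (dotp s u) - (1 - dotp s u ^+ 2 / 2)).
    rewrite (eq_bigr (fun s => p s * cos (dotp s u) - (p s - p s
      * dotp s u ^+ 2 / 2))) => [|s _]; last by ring.
    by rewrite !sumrB -mulr_suml p_sum Re_charf.
  rewrite mulr_suml.
  apply: le_trans (ler_norm_sum _ _ _) _; rewrite big_seq [leRHS]big_seq.
  apply: ler_sum => s /u1/cos_expansion sE.
  by rewrite normrM ger0_norm // -mulrA ler_wpM2l.
have ImE : `|Im (charf u)| <= (\sum_(s <- S) p s * `|dotp s u| ^+ 3) / 2.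
  have -> : Im (charf u) =
      \sum_(s <- S) p s * (sin (dotp s u) - dotp s u).
    rewrite (eq_bigr (fun s => p s * sin (dotp s u) - p s * dotp s u));
      last by move=> s _; ring.
    by rewrite sumrB p_mean subr0 Im_charf.
  rewrite mulr_suml.
  apply: le_trans (ler_norm_sum _ _ _) _; rewrite big_seq [leRHS]big_seq.
  apply: ler_sum => s /u1/sin_sub_le sE.
  by rewrite normrM ger0_norm // -mulrA ler_wpM2l // distrC.
have := ler_distD (1 - covar u / 2) (Re (charf u)) e.
rewrite (distrC (1 - covar u / 2) e); lra.
Qed.

End CharacteristicFunction.

(** * Fourier inversion on a square *)

Section SquareIntegral.
Variable R : realType.
Local Open Scope classical_set_scope.
Local Notation mu := (@lebesgue_measure R).
Local Notation mu2 := (mu \x mu)%E.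
Local Notation R2 := (measurableTypeR R * measurableTypeR R)%type.

(** The characters of Z^2, evaluated at u / L, run through one full period when
    u runs through the square. *)
Definition side (L : R) : set R := `[- (pi * L), pi * L].
Definition square (L : R) : set R2 := side L `*` side L.

Lemma measurable_square L : measurable (square L).
Proof. by apply: measurableX; exact: measurable_itv. Qed.

Lemma side_measure (L : R) : 0 < L -> mu (side L) = (2 * pi * L)%:E.
Proof.
move=> L0; rewrite /side lebesgue_measure_itv /= lte_fin.
have -> : - (pi * L) < pi * L by have := mulr_gt0 (pi_gt0 R) L0; lra.
by congr EFin; ring.
Qed.

Lemma square_measure (L : R) : 0 < L ->
  mu2 (square L) = ((2 * pi * L) ^+ 2)%:E.
Proof.
move=> L0; rewrite /square product_measure1E //; try exact: measurable_itv.
by rewrite expr2 EFinM; congr (_ * _)%E; exact: side_measure.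
Qed.

Lemma square_fin (L : R) : 0 < L -> (mu2 (square L) < +oo)%E.
Proof. by move=> L0; rewrite square_measure // ltry. Qed.

Lemma sin_int_pi (k : int) : sin (k%:~R * pi) = 0 :> R.
Proof.
have sn n : sin (n%:R * pi) = 0 :> R.
  by rewrite mulr_natl -[_ *+ n]add0r (alternatingn (@sinDpi R)) sin0 mulr0.
by case: k => n; rewrite ?NegzE ?mulrNz ?mulNr ?sinN sn ?oppr0.
Qed.

Lemma integral_side_cos (L c : R) (k : int) : 0 < L ->
  (\int[mu]_(y in side L) (cos (c + k%:~R * (L^-1 * y)))%:E)%E =
  (if k == 0 then 2 * pi * L * cos c else 0)%:E.
Proof.
move=> L0.
have piL : - (pi * L) < pi * L by have := mulr_gt0 (pi_gt0 R) L0; lra.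
have cf (f : R -> R) (A : set R) : (forall x : R, derivable f x 1) ->
    {within A, continuous f}.
  move=> df; apply: continuous_subspaceT => y; apply: differentiable_continuous.
  exact/derivable1_diffP.
have [->|k0] := eqVneq k 0.
  under eq_integral do rewrite mul0r addr0.
  rewrite integral_cst; last exact: measurable_itv.
  transitivity ((cos c)%:E * (2 * pi * L)%:E)%E.
    by congr (_ * _)%E; exact: side_measure.
  by rewrite -EFinM; congr EFin; ring.
have a0 : k%:~R * L^-1 != 0 :> R.
  rewrite mulf_neq0 //; first by rewrite intr_eq0.
  by rewrite invr_neq0 // lt0r_neq0.
pose g (y : R) := c + k%:~R * (L^-1 * y).
pose F (y : R) := (k%:~R * L^-1)^-1 * sin (g y).
have dg (y : R) : is_derive y 1 g (k%:~R * L^-1).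
  by apply: is_derive_eq; rewrite /GRing.scale /=; ring.
have dF (y : R) : is_derive y 1 F (cos (g y)).
  have ds := is_derive1_comp (is_derive_sin (g y)) (dg y).
  by apply: is_derive_eq; rewrite /GRing.scale /= mulrCA mulVf ?mulr1 //; ring.
have cF : continuous F.
  move=> y; apply: differentiable_continuous.
  exact/derivable1_diffP/ex_derive.
rewrite /side (continuous_FTC2 (F := F) piL).
- rewrite -EFinB; congr EFin; rewrite /F -mulrBr.
  have -> : g (pi * L) = c + k%:~R * pi.
    by rewrite /g [pi * L]mulrC mulKf // lt0r_neq0.
  have -> : g (- (pi * L)) = c - k%:~R * pi.
    by rewrite /g mulrN [pi * L]mulrC mulKf ?lt0r_neq0 // mulrN.
  by rewrite sinB sinD sin_int_pi; ring.
- apply: cf => x; apply: ex_derive.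
- split; first by move=> x _; exact: ex_derive.
    exact/cvg_at_right_filter/cF.
  exact/cvg_at_left_filter/cF.
- by move=> x _; rewrite derive1E derive_val.
Qed.

(** By Fubini, since sin vanishes at the integer multiples of pi. *)
Lemma integral_square_cos (L : R) (k : int * int) : 0 < L ->
  (\int[mu2]_(u in square L)
     (cos (dotp k (L^-1 * u.1, L^-1 * u.2)))%:E)%E =
  ((2 * pi * L) ^+ 2 * (k == 0)%:R)%:E.
Proof.
move=> L0; pose f (u : R2) := (cos (dotp k (L^-1 * u.1, L^-1 * u.2)))%:E.
have mf : measurable_fun setT f.
  apply/measurable_EFinP; apply: measurableT_comp.
    exact: (continuous_measurable_fun (@continuous_cos R)).
  by apply: measurable_funD; apply: measurable_funM => //;
    apply: measurable_funM.
have intf : mu2.-integrable (square L) f.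
  apply: (@measurable_bounded_integrable _ _ _ _ (fun u => cos _)).
  - exact: measurable_square.
  - exact: square_fin.
  - by apply: measurable_funTS; apply/measurable_EFinP.
  - by exists 1; split => // M M1 u _; exact: le_trans (cos_max _) (ltW M1).
rewrite integral_mkcond -integral12_prod_meas1; last first.
  by apply/(integrable_mkcond _ (measurable_square L)).
transitivity (\int[mu]_(x in side L) \int[mu]_(y in side L)
    (cos (k.1%:~R * (L^-1 * x) + k.2%:~R * (L^-1 * y)))%:E)%E.
  rewrite [RHS]integral_mkcond; apply: eq_integral => x _.
  rewrite /fubini_F [RHS]/patch; case: ifPn => xL; last first.
    rewrite integral0_eq // => y _; rewrite /patch in_setX.
    by rewrite (negbTE xL).
  rewrite [RHS]integral_mkcond; apply: eq_integral => y _.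
  by rewrite /patch in_setX xL.
under eq_integral do rewrite integral_side_cos //.
case: k {f mf intf} => k1 k2 /=.
have -> : ((k1, k2) == 0) = (k1 == 0) && (k2 == 0) by [].
have [k20|k20] := eqVneq k2 0; last by rewrite integral0_eq // andbF mulr0.
under eq_integral do rewrite EFinM -[k1%:~R * _]add0r.
rewrite integralZl /=; last first.
- apply: (@measurable_bounded_integrable _ _ _ _ (fun x => cos _)).
  + exact: measurable_itv.
  + by change (mu (side L) < +oo)%E; rewrite side_measure // ltry.
  + apply: measurable_funTS; apply: measurableT_comp.
      exact: (continuous_measurable_fun (@continuous_cos R)).
    by apply: measurable_funD => //; do 2 apply: measurable_funM => //.
  + by exists 1; split => // M M1 u _; exact: le_trans (cos_max _) (ltW M1).
- exact: measurable_itv.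
rewrite integral_side_cos // andbT -EFinM cos0 mulr1 expr2.
by case: eqP => _; rewrite ?mulr1 ?mulr0.
Qed.

End SquareIntegral.

Section FourierInversion.
Variables (R : realType) (S : seq (int * int)) (p : (int * int)%type -> R).
Hypothesis p_ge0 : forall s, 0 <= p s.
Hypothesis p_sum : \sum_(s <- S) p s = 1.
Implicit Types (k s : (int * int)%type).
Local Open Scope classical_set_scope.
Local Open Scope complex_scope.
Local Notation mu := (@lebesgue_measure R).
Local Notation mu2 := (mu \x mu)%E.
Local Notation R2 := (measurableTypeR R * measurableTypeR R)%type.
Notation normc := (@ComplexField.Normc.normc R).
Local Notation charf := (charf S p).

(** The integrand of Fourier inversion; its real part is enough because
    transition probabilities are real. *)
Definition fterm m k (u : R * R) : R :=
  complex.Re (charf u ^+ m * cis (- dotp k u)).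

Lemma fterm0 k u : fterm 0 k u = cos (dotp k u).
Proof. by rewrite /fterm expr0 mul1r /= cosN. Qed.

Lemma ftermS m k u :
  fterm m.+1 k u = \sum_(s <- S) p s * fterm m (k - s) u.
Proof.
rewrite /fterm exprS {1}/charf -mulrA mulr_suml Re_sum.
apply: eq_bigr => s _; rewrite -mulrA ReZ; congr (_ * complex.Re _).
by rewrite mulrCA -cisD dotpB; congr (_ * cis _); ring.
Qed.

Lemma norm_fterm m k u : `|fterm m k u| <= normc (charf u) ^+ m.
Proof.
apply: le_trans (Re_le_normc _) _.
by rewrite ComplexField.Normc.normcM normc_cis mulr1 normcX.
Qed.

Lemma measurable_fterm (b : R) m k :
  measurable_fun [set: R2] (fun u => fterm m k (b * u.1, b * u.2)).
Proof.
elim: m k => [|m IH] k.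
  under eq_fun do rewrite fterm0.
  apply: measurableT_comp.
    exact: (continuous_measurable_fun (@continuous_cos R)).
  by apply: measurable_funD; apply: measurable_funM => //;
    apply: measurable_funM.
under eq_fun do rewrite ftermS.
by apply: measurable_sum => s; apply: measurable_funM.
Qed.

Lemma integrable_fterm (L : R) m k : 0 < L ->
  mu2.-integrable (square L)
    (fun u => (fterm m k (L^-1 * u.1, L^-1 * u.2))%:E).
Proof.
move=> L0.
apply: (@measurable_bounded_integrable _ _ _ _ (fun u => fterm _ _ _)).
- exact: measurable_square.
- exact: square_fin.
- by apply: measurable_funTS; exact: measurable_fterm.
exists 1; split => // M M1 u _; apply: le_trans (norm_fterm _ _ _) _.
by apply: le_trans (ltW M1); rewrite exprn_ile1 ?normc_ge0 ?charf_le1.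
Qed.

Variable P : nat -> (int * int)%type -> R.
Hypothesis P0 : forall k, P 0 k = (k == 0)%:R.
Hypothesis PS : forall m k, P m.+1 k = \sum_(s <- S) p s * P m (k - s).

(** By induction on m, both sides obeying the recursion of P. The scale L stays
    free in this induction; L = sqrt m is the scale of the central limit
    theorem. *)
Lemma fourier_inversion (L : R) m k : 0 < L ->
  (\int[mu2]_(u in square L) (fterm m k (L^-1 * u.1, L^-1 * u.2))%:E)%E =
  ((2 * pi * L) ^+ 2 * P m k)%:E.
Proof.
move=> L0; elim: m k => [|m IH] k.
  under eq_integral do rewrite fterm0.
  by rewrite integral_square_cos // P0.
under eq_integral do rewrite ftermS -sumEFin.
rewrite integral_sum; [|exact: measurable_square|]; last first.
  move=> s; under eq_fun do rewrite EFinM.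
  by apply: integrableZl; [exact: measurable_square|exact: integrable_fterm].
rewrite PS mulr_sumr -sumEFin; apply: eq_bigr => s _.
under eq_integral do rewrite EFinM.
rewrite integralZl; [|exact: measurable_square|exact: integrable_fterm].
by rewrite IH -EFinM; congr EFin; ring.
Qed.

End FourierInversion.

(** * A local limit theorem *)

Section LocalLimit.
Variables (R : realType) (S : seq (int * int)) (p : (int * int)%type -> R).
Hypothesis p_ge0 : forall s, 0 <= p s.
Hypothesis p_sum : \sum_(s <- S) p s = 1.
Hypothesis p_mean : forall u, \sum_(s <- S) p s * dotp s u = 0.
Implicit Types (k s : (int * int)%type).
Local Open Scope classical_set_scope.
Local Open Scope complex_scope.
Local Notation mu := (@lebesgue_measure R).
Local Notation mu2 := (mu \x mu)%E.
Local Notation R2 := (measurableTypeR R * measurableTypeR R)%type.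
Local Notation normc := (@ComplexField.Normc.normc R).
Local Notation charf := (charf S p).
Local Notation covar := (covar S p).

(** Quantitative central limit theorem at a fixed frequency: the m-th powers of
    two numbers of the unit disc differ by at most m times their distance,
    which is of order L^-3 when m = L^2. *)
Lemma fterm_gauss (L : R) m k u : 1 <= L -> L ^+ 2 = m%:R ->
  {in S, forall s, `|dotp s u| <= L} -> `|dotp k u| <= L ->
  `|fterm S p m k (L^-1 * u.1, L^-1 * u.2) - expR (- (covar u / 2))| <=
  L^-1 * (\sum_(s <- S) p s * `|dotp s u| ^+ 3 + covar u ^+ 2 / 4
          + 2 * `|dotp k u|).
Proof.
move=> L1 Lm Su ku; have L0 : 0 < L by lra.
set b := L^-1; have b0 : 0 < b by rewrite invr_gt0.
have b1 : b <= 1 by rewrite invf_le1.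
have bL : b * L = 1 by rewrite mulVf ?gt_eqF.
have mb : m%:R * b ^+ 2 = 1 by rewrite -Lm -exprMn mulrC bL expr1n.
set v := (b * u.1, b * u.2).
have dotv s : `|dotp s v| = b * `|dotp s u|.
  by rewrite dotpZ normrM gtr0_norm.
have small s : `|dotp s u| <= L -> `|dotp s v| <= 1.
  by move=> sL; rewrite dotv -bL ler_wpM2l // ltW.
rewrite /fterm -/v; set z := charf v; set w := cis _.
set r := expR (- (covar v / 2)).
have r1 : normc r%:C <= 1.
  rewrite normc_real gtr0_norm ?expR_gt0 // expR_le1 oppr_le0.
  by rewrite divr_ge0 ?covar_ge0.
have rm : r ^+ m = expR (- (covar u / 2)).
  rewrite -expRM_natl covarZ; congr expR.
  by rewrite mulrN mulrA mulrA mb mul1r.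
have zr : normc (z - r%:C) <=
    b ^+ 3 * (\sum_(s <- S) p s * `|dotp s u| ^+ 3 + covar u ^+ 2 / 4).
  apply: le_trans (charf_gauss p_ge0 p_sum p_mean _) _.
    by move=> s sS; apply: small; exact: Su.
  rewrite covarZ mulrDr; apply: lerD.
    rewrite mulr_sumr le_eqVlt; apply/orP; left; apply/eqP.
    by apply: eq_bigr => s _; rewrite dotv; ring.
  have : 0 <= covar u ^+ 2 by rewrite sqr_ge0.
  have : b ^+ 4 <= b ^+ 3 by rewrite exprS ler_piMl // exprn_ge0 // ltW.
  set c := covar u ^+ 2; set b4 := b ^+ 4; move=> bb c0.
  have : b4 * c <= b ^+ 3 * c by apply: ler_wpM2r.
  rewrite /b4 /c; lra.
have w1 : normc (w - 1) <= b * (2 * `|dotp k u|).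
  apply: le_trans (normc_le_ReIm _) _.
  rewrite !raddfB /= subr0 cosN sinN normrN.
  have := norm_sin_le (dotp k v); have := one_sub_cos_le (dotp k v).
  have := small k ku; rewrite (distrC (cos _)).
  rewrite (@ger0_norm _ (1 - cos _)) ?subr_ge0 ?cos_le1 //.
  rewrite -[dotp k v ^+ 2]real_normK ?num_real // mulrCA -dotv.
  set t := `|dotp k v|; have t0 : 0 <= t := normr_ge0 _.
  nra.
rewrite -rm [r ^+ m](_ : _ = complex.Re (r%:C ^+ m)); last first.
  by rewrite -rmorphXn.
rewrite -(raddfB (@complex.Re R)); apply: le_trans (Re_le_normc _) _.
have -> : z ^+ m * w - r%:C ^+ m =
    (z ^+ m - r%:C ^+ m) * w + r%:C ^+ m * (w - 1).
  by ring.
apply: le_trans (le_normcD _ _) _; rewrite [leRHS]mulrDr; apply: lerD.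
  rewrite ComplexField.Normc.normcM normc_cis mulr1.
  apply: le_trans (normc_expr_sub _ (charf_le1 _ _ _) r1) _ => //.
  apply: le_trans (ler_wpM2l (ler0n _ m) zr) _.
  by rewrite exprSr mulrA mulrA mb mul1r.
rewrite ComplexField.Normc.normcM normcX; apply: le_trans w1.
by rewrite ler_piMl ?normc_ge0 // exprn_ile1 ?normc_ge0.
Qed.

End LocalLimit.

Section GaussianIntegrable.
Variable R : realType.
Local Open Scope classical_set_scope.
Local Notation mu := (@lebesgue_measure R).
Local Notation mu2 := (mu \x mu)%E.
Local Notation R2 := (measurableTypeR R * measurableTypeR R)%type.

Lemma integrable_gauss (a : R) : 0 < a ->
  mu.-integrable setT (fun x => (expR (- (a * x ^+ 2)))%:E).
Proof.
move=> a0; pose sg := (Num.sqrt (2 * a))^-1.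
have sg0 : 0 < sg by rewrite invr_gt0 sqrtr_gt0 mulr_gt0.
have sgn0 : sg != 0 by rewrite gt_eqF.
have pk0 := normal_peak_gt0 sgn0.
have -> : (fun x : R => (expR (- (a * x ^+ 2)))%:E) =
    (fun x => ((normal_peak sg)^-1)%:E * (normal_pdf 0 sg x)%:E)%E.
  apply/funext => x; rewrite -EFinM normal_pdfE // mulKf ?gt_eqF //.
  congr (expR _)%:E; rewrite subr0 /sg exprVn sqr_sqrtr ?mulr_ge0 ?ltW //.
  by rewrite mulNr; congr (- _); field; rewrite gt_eqF.
by apply: integrableZl => //; exact: integrable_normal_pdf.
Qed.

Lemma integrable_gauss2 (a : R) : 0 < a ->
  mu2.-integrable [set: R2]
    (fun u => (expR (- (a * (u.1 ^+ 2 + u.2 ^+ 2))))%:E).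
Proof.
move=> a0; have ig := integrable_gauss a0.
have mg : measurable_fun [set: R2]
    (fun u => (expR (- (a * (u.1 ^+ 2 + u.2 ^+ 2))))%:E).
  apply/measurable_EFinP; apply: measurableT_comp => //.
  apply: measurableT_comp => //; apply: measurable_funM => //.
  by apply: measurable_funD; apply: measurable_funX.
apply/(@integrable12ltyP _ _ _ _ _ mu mu _ mg).2.
pose I := (\int[mu]_x (expR (- (a * x ^+ 2)))%:E)%E.
have Ifin : I \is a fin_num by exact: integrable_fin_num.
rewrite (eq_integral (fun x : measurableTypeR R =>
  (fine I)%:E * (expR (- (a * (x : R) ^+ 2)))%:E)%E).
  by rewrite integralZl // -/I -(fineK Ifin) -EFinM ltry.
move=> x _; rewrite fineK // muleC -integralZl //.
apply: eq_integral => y _ /=.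
by rewrite ger0_norm ?expR_ge0 // -EFinM -expRD; congr (expR _)%:E; ring.
Qed.

End GaussianIntegrable.

Section LocalLimitTheorem.
Variables (R : realType) (S : seq (int * int)) (p : (int * int)%type -> R).
Hypothesis p_ge0 : forall s, 0 <= p s.
Hypothesis p_sum : \sum_(s <- S) p s = 1.
Hypothesis p_mean : forall u, \sum_(s <- S) p s * dotp s u = 0.
Implicit Types (k s : (int * int)%type).
Local Open Scope classical_set_scope.
Local Notation mu := (@lebesgue_measure R).
Local Notation mu2 := (mu \x mu)%E.
Local Notation R2 := (measurableTypeR R * measurableTypeR R)%type.
Local Notation normc := (@ComplexField.Normc.normc R).
Local Notation charf := (charf S p).
Local Notation covar := (covar S p).

Variable kappa : R.
Hypothesis kappa_gt0 : 0 < kappa.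
(* This encodes both aperiodicity and nondegeneracy of the covariance. *)
Hypothesis charf_bound : forall u : R2, square 1 u ->
  kappa * (u.1 ^+ 2 + u.2 ^+ 2) <= 1 - normc (charf u) ^+ 2.

Variable P : nat -> (int * int)%type -> R.
Hypothesis P0 : forall k, P 0 k = (k == 0)%:R.
Hypothesis PS : forall m k, P m.+1 k = \sum_(s <- S) p s * P m (k - s).

Let L n : R := Num.sqrt n.+1%:R.

Let L_sqr n : L n ^+ 2 = n.+1%:R.
Proof. by rewrite sqr_sqrtr. Qed.

Let L_ge1 n : 1 <= L n.
Proof. by rewrite -sqrtr1 ler_wsqrtr // ler1n. Qed.

Let L_gt0 n : 0 < L n.
Proof. exact: lt_le_trans (L_ge1 n). Qed.

Let gauss (u : R2) : R := expR (- (covar u / 2)).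

Let majorant (u : R2) : R := expR (- (kappa / 2 * (u.1 ^+ 2 + u.2 ^+ 2))).

Let scaled k n : R2 -> \bar R :=
  (fun u => (fterm S p n.+1 k ((L n)^-1 * u.1, (L n)^-1 * u.2))%:E)
    \_ (square (L n)).

Let integrable_majorant : mu2.-integrable [set: R2] (EFin \o majorant).
Proof. by apply: integrable_gauss2; rewrite divr_gt0. Qed.

Let measurable_gauss : measurable_fun [set: R2] gauss.
Proof.
apply: measurableT_comp => //; apply: measurableT_comp => //.
apply: measurable_funM => //; apply: measurable_sum => s.
apply: measurable_funM => //; apply: measurable_funX.
by apply: measurable_funD; apply: measurable_funM.
Qed.

Let integral_scaled k n :
  (\int[mu2]_u scaled k n u)%E = ((2 * pi) ^+ 2 * (n.+1%:R * P n.+1 k))%:E.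
Proof.
rewrite -integral_mkcond (fourier_inversion p_ge0 p_sum P0 PS) //.
by congr EFin; rewrite exprMn L_sqr; ring.
Qed.

Let measurable_scaled k n : measurable_fun setT (scaled k n).
Proof.
apply/(measurable_restrictT _ _).1; first exact: measurable_square.
by apply: measurable_funTS; apply/measurable_EFinP; exact: measurable_fterm.
Qed.

Let scaled_le k n u : (`|scaled k n u| <= (majorant u)%:E)%E.
Proof.
rewrite /scaled /patch; case: ifPn => uL.
  2: by rewrite abse0 lee_fin expR_ge0.
rewrite lee_fin; apply: le_trans (norm_fterm _ _ _ _ _) _.
set v := (_, _); set z := normc _.
have z0 : 0 <= z := normc_ge0 _.
have Ln := L_gt0 n; have L2 := L_sqr n.
have v1 : square 1 v.
  move: uL; rewrite inE /square /side => -[] /=; rewrite !in_itv /= !mulr1.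
  rewrite ![_^-1 * _]mulrC !ler_pdivrMr // !ler_pdivlMr // !mulNr.
  by move=> -> ->.
have := charf_bound v1; rewrite -/z => zb.
have zE : z <= expR (- (kappa / 2 * (v.1 ^+ 2 + v.2 ^+ 2))).
  rewrite -(@ler_pXn2r _ 2) ?nnegrE ?expR_ge0 // -expRM_natl.
  apply: (le_trans _ (expR_ge1Dx _)); lra.
have : z ^+ n.+1 <= expR (- (kappa / 2 * (v.1 ^+ 2 + v.2 ^+ 2))) ^+ n.+1.
  by rewrite lerXn2r ?nnegrE ?expR_ge0.
move=> /le_trans; apply; rewrite -expRM_natl -L2 /v /majorant /=.
rewrite le_eqVlt; apply/orP; left; apply/eqP; congr expR.
by field; rewrite gt_eqF.
Qed.

Let scaled_cvg k u : scaled k ^~ u @ \oo --> (gauss u)%:E.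
Proof.
pose T := `|u.1| / pi + `|u.2| / pi + \sum_(s <- S) `|dotp s u| + `|dotp k u|.
pose K := \sum_(s <- S) p s * `|dotp s u| ^+ 3 + covar u ^+ 2 / 4
          + 2 * `|dotp k u|.
have nearL (M : R) : \forall n \near \oo, M <= L n.
  near=> n; have [M0|/ltW M0] := leP 0 M.
    2: exact: le_trans M0 (ltW (L_gt0 n)).
  rewrite -[M]ger0_norm // -sqrtr_sqr ler_wsqrtr //.
  apply: le_trans (_ : n%:R <= _); last by rewrite ler_nat.
  by near: n; exact: nbhs_infty_ger.
have a1 : 0 <= `|u.1| / pi by rewrite divr_ge0 ?pi_ge0.
have a2 : 0 <= `|u.2| / pi by rewrite divr_ge0 ?pi_ge0.
have a3 : 0 <= \sum_(s <- S) `|dotp s u| by rewrite sumr_ge0.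
have a4 : 0 <= `|dotp k u| by [].
have T1 : `|u.1| / pi <= T by rewrite /T; lra.
have T2 : `|u.2| / pi <= T by rewrite /T; lra.
have T3 s : s \in S -> `|dotp s u| <= T.
  move=> sS; suff : `|dotp s u| <= \sum_(s <- S) `|dotp s u| by rewrite /T; lra.
  by rewrite (big_rem s) //= lerDl sumr_ge0.
have T4 : `|dotp k u| <= T by rewrite /T; lra.
apply: (@cvg_trans _ ((fterm S p n.+1 k ((L n)^-1 * u.1, (L n)^-1 * u.2))%:E
    @[n --> \oo])).
  apply: near_eq_cvg; near=> n; rewrite /scaled /patch mem_set //.
  have TL : T <= L n by near: n; exact: nearL.
  have pi0 := pi_gt0 R.
  split; rewrite /side /= in_itv /= -ler_norml mulrC -ler_pdivrMr //.
    exact: le_trans T1 TL.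
  exact: le_trans T2 TL.
apply: cvg_EFin; first exact: nearW.
apply/cvgrPdist_le => e e0; near=> n.
have TL : T <= L n by near: n; exact: nearL.
rewrite distrC.
apply: le_trans (fterm_gauss p_ge0 p_sum p_mean _ _ _ _) _ => //.
- by move=> s /T3 sT; exact: le_trans TL.
- exact: le_trans TL.
rewrite ler_pdivrMl // -ler_pdivrMr //.
by near: n; exact: nearL.
Unshelve. all: by end_near. Qed.

Let dominated k :
  mu2.-integrable [set: R2] (EFin \o gauss) /\
  (\int[mu2]_u scaled k n u)%E @[n --> \oo] --> (\int[mu2]_u (gauss u)%:E)%E.
Proof.
have [|||ig _ cv] := @dominated_convergence _ _ _ mu2 setT measurableT
  (scaled k) (EFin \o gauss) (EFin \o majorant) (measurable_scaled k) _ _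
  integrable_majorant.
- exact/measurable_EFinP.
- by apply: aeW => u _; exact: scaled_cvg.
- by apply: aeW => u n _; exact: scaled_le.
by split.
Qed.

(** Fourier inversion at scale sqrt m presents (2 pi)^2 m P m k as the integral
    of a function that is dominated by a fixed Gaussian and converges to the
    Gaussian of the covariance of the steps, whatever k is. *)
Theorem local_limit : exists2 c : R, 0 < c &
  (exists C : R, forall m k, `|m%:R * P m k| <= C) /\
  (forall k, m%:R * P m k @[m --> \oo] --> c).
Proof.
have ig := (dominated 0).1.
have pi0 := pi_gt0 R.
have pi2 : 0 < (2 * pi : R) ^+ 2 by rewrite exprn_gt0 // mulr_gt0.
have Gfin : (\int[mu2]_u (gauss u)%:E)%E \is a fin_num.
  exact: integrable_fin_num.
have Mfin : (\int[mu2]_u (majorant u)%:E)%E \is a fin_num.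
  exact: integrable_fin_num.
pose G := fine (\int[mu2]_u (gauss u)%:E)%E.
pose M := fine (\int[mu2]_u (majorant u)%:E)%E.
have M0 : 0 <= M.
  by apply: fine_ge0; apply: integral_ge0 => u _; rewrite lee_fin expR_ge0.
have bound m k : `|m%:R * P m k| <= M / (2 * pi) ^+ 2.
  case: m => [|n]; first by rewrite mul0r normr0 divr_ge0 // ltW.
  rewrite ler_pdivlMr // -[X in _ * X]gtr0_norm // -normrM mulrC.
  rewrite -lee_fin -abse_EFin -integral_scaled fineK //.
  apply: le_trans (le_abse_integral _ _ _) _ => //.
  apply: ge0_le_integral => //.
  - by apply: measurableT_comp.
  - exact: measurable_int integrable_majorant.
have G0 : 0 < G.
  (* The covariance form is at most B on the square. *)
  pose B := \sum_(s <- S) p s * ((`|s.1%:~R| + `|s.2%:~R|) * pi) ^+ 2.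
  have gB u : square 1 u -> expR (- (B / 2)) <= gauss u.
    rewrite /square /side => -[]; rewrite /= !in_itv /= !mulr1 -!ler_norml.
    move=> u1 u2; rewrite ler_expR lerN2 ler_wpM2r //; apply: ler_sum => s _.
    rewrite ler_wpM2l // -[leLHS]real_normK ?num_real // lerXn2r ?nnegrE //.
      by apply: mulr_ge0; [exact: addr_ge0|exact: pi_ge0].
    apply: le_trans (ler_normD _ _) _; rewrite !normrM mulrDl.
    by rewrite lerD // ler_wpM2l.
  rewrite -lte_fin /G fineK //.
  apply: (@lt_le_trans _ _ (\int[mu2]_(u in square 1) (expR (- (B / 2)))%:E)%E).
    rewrite integral_cst; last exact: measurable_square.
    rewrite -[X in (_ * X)%E]/(mu2 (square 1)) square_measure // -EFinM lte_fin.
    by rewrite mulr_gt0 ?expR_gt0 // mulr1.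
  apply: (@le_trans _ _ (\int[mu2]_(u in square 1) (gauss u)%:E)%E).
    apply: ge0_le_integral => //.
    - exact: measurable_square.
    - by apply: measurable_funTS; apply/measurable_EFinP.
  apply: ge0_subset_integral => //.
  - exact: measurable_square.
  - exact/measurable_EFinP.
  - by move=> u _; rewrite lee_fin expR_ge0.
exists (G / (2 * pi) ^+ 2); first by rewrite divr_gt0.
split; first by exists (M / (2 * pi) ^+ 2).
move=> k; rewrite -(cvg_shiftS (fun m => m%:R * P m k)) /=.
have := (dominated k).2; under eq_fun do rewrite integral_scaled.
rewrite -(fineK Gfin) => /fine_cvg /= cv.
rewrite [X in X @ _](_ : _ = fun n => ((2 * pi) ^+ 2)^-1 *
  ((2 * pi) ^+ 2 * (n.+1%:R * P n.+1 k))).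
  by rewrite mulrC; apply: cvgMr.
by apply/funext => n; rewrite mulKf // gt_eqF.
Qed.

End LocalLimitTheorem.

(** * The tilted walk at the critical point *)

Section CriticalPoint.
Local Open Scope classical_set_scope.
Variable R : realType.

Lemma one_sub_cosB (x y : R) :
  1 - cos (x - y) <= 2 * (1 - cos x) + 2 * (1 - cos y).
Proof.
rewrite !one_sub_cos mulrBl sinB.
have := cos2Dsin2 (x / 2); have := cos2Dsin2 (y / 2).
set a := cos (x / 2); set b := sin (x / 2); set d := cos (y / 2).
set e := sin (y / 2) => yE xE.
have : 0 <= (b * d + a * e) ^+ 2 by rewrite sqr_ge0.
have dE : d ^+ 2 = 1 - e ^+ 2 by lra.
have aE : a ^+ 2 = 1 - b ^+ 2 by lra.
have : 0 <= b ^+ 2 * e ^+ 2 by rewrite mulr_ge0 // sqr_ge0.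
have -> : (b * d - a * e) ^+ 2 = 2 * (b ^+ 2 * d ^+ 2 + a ^+ 2 * e ^+ 2)
   - (b * d + a * e) ^+ 2 by ring.
rewrite dE aE; lra.
Qed.

(** The critical equations of S at a point with positive coordinates amount to
    x = y^2 and y^4 = y + 3. *)
Lemma critical_point : exists2 r : R, 1 < r < 2 & r ^+ 4 = r + 3.
Proof.
pose q : {poly R} := 'X^4 - 'X - 3%:P.
have qE x : q.[x] = x ^+ 4 - x - 3 by rewrite !hornerE.
have [||x /andP[x1 x2] /eqP] := @poly_ivt R q 1 2; first by rewrite ler1n.
  by rewrite !qE; apply/andP; split; lra.
rewrite qE => /eqP qx; exists x; last by lra.
rewrite !lt_neqAle x1 x2 !andbT; apply/andP; split; apply/eqP => xE.
  by move: qx; rewrite -xE; lra.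
by move: qx; rewrite xE; lra.
Qed.

Variable r : R.
Hypotheses (r12 : 1 < r < 2) (rE : r ^+ 4 = r + 3).

Let r0 : 0 < r. Proof. by case/andP: r12 => /(lt_trans _)->. Qed.

(** The value at k of the monomial x^i y^j at the critical point (r^2, r) of
    S. *)
Definition tilt (k : int * int) : R := r ^ (k.1 * 2 + k.2).

(** This is S(r^2, r). *)
Definition growth : R := \sum_(s <- steps) tilt s.

Definition tilted_step (s : int * int) : R := tilt s / growth.

Definition tilted_coef m k : R :=
  ratr (lcoef (step_poly ^+ m) k) * tilt k / growth ^+ m.

Lemma tilt_gt0 k : 0 < tilt k.
Proof. exact: exprz_gt0. Qed.

Lemma tiltD k l : tilt (k + l) = tilt k * tilt l.
Proof.
by rewrite /tilt -expfzDr ?gt_eqF //; congr (r ^ _); rewrite /= mulrDl addrACA.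
Qed.

Lemma tilt_nat (a b : nat) : tilt (a%:Z, b%:Z) = r ^+ (a.*2 + b).
Proof.
rewrite /tilt /= (_ : a%:Z * 2 + b%:Z = (a.*2 + b)%N%:Z) ?exprnP //.
by rewrite -muln2 PoszD PoszM.
Qed.

Lemma tilt_steps : (tilt (0, 1) = r) * (tilt (1, -1) = r) *
  (tilt (-1, -1) = r^-1 ^+ 3) * (tilt (-2, 1) = r^-1 ^+ 3) *
  (tilt (-1, 0) = r^-1 ^+ 2).
Proof. by rewrite !exprVn. Qed.

Lemma growth_gt0 : 0 < growth.
Proof. by rewrite /growth big_steps !addr_gt0 // tilt_gt0. Qed.

Lemma tilted_step_gt0 s : 0 < tilted_step s.
Proof. by rewrite divr_gt0 ?tilt_gt0 ?growth_gt0. Qed.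

Lemma tilted_step_sum : \sum_(s <- steps) tilted_step s = 1.
Proof. by rewrite -mulr_suml divff // gt_eqF ?growth_gt0. Qed.

(** Centring amounts to r = r^-2 + 3 r^-3, the equation of r. *)
Lemma tilted_step_mean u : \sum_(s <- steps) tilted_step s * dotp s u = 0.
Proof.
have ri : r * r^-1 = 1 by rewrite divff // gt_eqF.
rewrite big_steps /tilted_step !tilt_steps /dotp /=.
have rE3 : r = 1 * r^-1 ^+ 2 + 3 * r^-1 ^+ 3.
  by field: rE; rewrite gt_eqF.
transitivity (growth^-1 * (r - (r^-1 ^+ 2 + 3 * r^-1 ^+ 3)) * u.1).
  by ring.
by rewrite {1}rE3; ring.
Qed.

Lemma tilted_coef0 k : tilted_coef 0 k = (k == 0)%:R.
Proof.
rewrite /tilted_coef !expr0 invr1 mulr1 -lmono0 lmonoE eq_sym ratr_nat.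
by case: eqP => [->|_]; rewrite ?mul0r // mul1r.
Qed.

Lemma tilted_coefS m k :
  tilted_coef m.+1 k = \sum_(s <- steps) tilted_step s * tilted_coef m (k - s).
Proof.
rewrite /tilted_coef free_coefS rmorph_sum !mulr_suml; apply: eq_bigr => s _.
have -> : tilt k = tilt (k - s) * tilt s by rewrite -tiltD subrK.
by rewrite /tilted_step exprSr invfM /=; ring.
Qed.

(** The differences of steps (-1, 0) - (-1, -1) = (0, 1) and
    (0, 1) - (-1, 0) = (1, 1) generate the lattice, so that the characteristic
    function has modulus 1 at the origin only. *)
Lemma charf_tilted_bound : exists2 kappa, 0 < kappa & forall u,
  square 1 u -> kappa * (u.1 ^+ 2 + u.2 ^+ 2) <=
  1 - ComplexField.Normc.normc (charf steps tilted_step u) ^+ 2.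
Proof.
have pg := tilted_step_gt0.
pose q := tilted_step (-1, 0)
  * Num.min (tilted_step (0, 1)) (tilted_step (-1, -1)).
have q0 : 0 < q by rewrite mulr_gt0 ?pg // lt_min !pg.
(* 24 = 8 * 3, with 8 from cos_le_quadratic, and 3 from bounding 1 - cos u.1 by
   2 (1 - cos (u.1 + u.2)) + 2 (1 - cos u.2). *)
exists (q / 24); first by rewrite divr_gt0.
move=> u; rewrite /square /side => -[].
rewrite /= !in_itv /= !mulr1 -!ler_norml.
move=> u1 u2; rewrite (one_sub_charf_sqr tilted_step_sum).
have term0 s t :
    0 <= tilted_step s * tilted_step t * (1 - cos (dotp (s - t) u)).
  by rewrite mulr_ge0 ?subr_ge0 ?cos_le1 // mulr_ge0 // ltW.
apply: (@le_trans _ _ (\sum_(t <- steps) tilted_step (-1, 0) * tilted_step t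
    * (1 - cos (dotp ((-1, 0) - t) u)))); last first.
  have sm : (-1, 0) \in (steps : seq _) by rewrite !inE.
  rewrite [leRHS](big_rem _ sm) /= lerDl; apply: sumr_ge0 => s _.
  by apply: sumr_ge0.
have sum0 := term0 (-1, 0).
rewrite big_steps.
apply: (@le_trans _ _ (tilted_step (-1, 0) * tilted_step (0, 1)
    * (1 - cos (dotp ((-1, 0) - (0, 1)) u))
  + tilted_step (-1, 0) * tilted_step (-1, -1)
    * (1 - cos (dotp ((-1, 0) - (-1, -1)) u)))); last first.
  by have := sum0 (1, -1); have := sum0 (-2, 1); have := sum0 (-1, 0); lra.
have -> : dotp ((-1, 0) - (0, 1)) u = - (u.1 + u.2) by rewrite /dotp /=; ring.
have -> : dotp ((-1, 0) - (-1, -1)) u = u.2 by rewrite /dotp /=; ring.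
rewrite cosN; set X := 1 - cos (u.1 + u.2); set Y := 1 - cos u.2.
have X0 : 0 <= X by rewrite subr_ge0 cos_le1.
have Y0 : 0 <= Y by rewrite subr_ge0 cos_le1.
apply: (@le_trans _ _ (q * X + q * Y)).
  have := one_sub_cosB (u.1 + u.2) u.2; rewrite addrK -/X -/Y => XY.
  have := cos_le_quadratic u1; have := cos_le_quadratic u2; rewrite -/Y.
  move=> h2 h1; have h : (u.1 ^+ 2 + u.2 ^+ 2) / 24 <= X + Y by lra.
  by have := ler_wpM2l (ltW q0) h; lra.
by apply: lerD; apply: ler_wpM2r => //; apply: ler_wpM2l;
  rewrite ?ge_min ?lexx ?orbT ?(ltW (pg _)).
Qed.

(** Undoing the tilt, the coefficient of S^m at a fixed k is equivalent to
    c growth^m / (m tilt k). *)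
Theorem tilted_local_limit : exists2 c : R, 0 < c &
  (exists C : R, forall m k, `|m%:R * tilted_coef m k| <= C) /\
  (forall k, (fun m => m%:R * tilted_coef m k) @ \oo --> c).
Proof.
have [kappa kappa0 bound] := charf_tilted_bound.
apply: (local_limit (p := tilted_step) _ tilted_step_sum tilted_step_mean
  kappa0 bound tilted_coef0 tilted_coefS).
by move=> s; apply: ltW; exact: tilted_step_gt0.
Qed.

End CriticalPoint.

(** * Dominated convergence for series *)

Section Tannery.
Variable R : realType.
Local Open Scope classical_set_scope.

(** Beyond a fixed index both sums are bounded by the tail of the dominating
    series, and the finitely many remaining terms converge. *)
Lemma tannery (f : nat -> nat -> R) (M g : nat -> R) (N : nat -> nat) :
  (forall n i, `|f n i| <= M i) -> cvgn (series M) ->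
  (forall i, (fun n => f n i) @ \oo --> g i) -> (forall n, (n <= N n)%N) ->
  (fun n => \sum_(i < N n) f n i) @ \oo --> limn (series g).
Proof.
move=> fM cM fg nN.
have M0 i : 0 <= M i := le_trans (normr_ge0 _) (fM 0%N i).
have gM i : `|g i| <= M i.
  apply/ler_addgt0Pr => e e0.
  have /cvgrPdist_le/(_ e e0)[n _ /(_ n (leqnn n)) /= gf] := fg i.
  have := ler_distD (f n i) (g i) 0; rewrite !subr0.
  have := fM n i; lra.
have cg : cvgn (series g).
  apply: normed_cvg.
  exact: (series_le_cvg (fun i => normr_ge0 (g i)) M0 gM cM).
have Mle n : series M n <= limn (series M).
  by apply: nondecreasing_cvgn_le => //; exact: nondecreasing_series.
apply/cvgrPdist_le => e e0.
have e3 : 0 < e / 3 by rewrite divr_gt0.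
have /cvgrPdist_le/(_ _ e3)[K1 _ HK1] := cM.
have /cvgrPdist_le/(_ _ e3)[K2 _ HK2] := cg.
pose K := maxn K1 K2.
have MK : limn (series M) - series M K <= e / 3.
  by apply: le_trans (ler_norm _) _; apply: HK1; rewrite /= leq_maxl.
have gK : `|limn (series g) - series g K| <= e / 3.
  by apply: HK2; rewrite /= leq_maxr.
have cK : (fun n => \sum_(i < K) f n i) @ \oo --> \sum_(i < K) g i.
  elim: (K) => [|k IH].
    by rewrite big_ord0; under eq_fun do rewrite big_ord0; exact: cvg_cst.
  rewrite big_ord_recr; under eq_fun do rewrite big_ord_recr.
  by apply: cvgD => //; exact: fg.
near=> n.
have Kn : (K <= N n)%N.
  by apply: leq_trans (nN n); near: n; exact: nbhs_infty_ge.
have fK : `|\sum_(i < K) g i - \sum_(i < K) f n i| <= e / 3.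
  by near: n; move/cvgrPdist_le : cK; exact.
have tail : `|\sum_(i < N n) f n i - \sum_(i < K) f n i| <= e / 3.
  rewrite -!(big_mkord xpredT (f n)) (big_cat_nat _ Kn) //= addrAC subrr add0r.
  apply: le_trans (ler_norm_sum _ _ _) _.
  apply: (@le_trans _ _ (\sum_(K <= i < N n) M i)); first exact: ler_sum.
  have := sub_series_geq M Kn; have := Mle (N n); lra.
move: gK fK tail; rewrite /series /= big_mkord.
have := ler_distD (\sum_(i < K) g i) (limn (series g)) (\sum_(i < N n) f n i).
have := ler_distD (\sum_(i < K) f n i) (\sum_(i < K) g i)
  (\sum_(i < N n) f n i).
rewrite (distrC (\sum_(i < K) f n i)); lra.
Unshelve. all: by end_near. Qed.

Lemma geometric_partial_sum (x : R) n : 0 <= x < 1 ->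
  \sum_(i < n) x ^+ i <= (1 - x)^-1.
Proof.
move=> /andP[x0 x1]; rewrite -[leRHS]mul1r ler_pdivlMr ?subr_gt0 //.
by have := subrX1 x n; have := exprn_ge0 n x0; lra.
Qed.

End Tannery.

(** * Asymptotics of the numbers of walks *)

Section Endpoints.

Lemma qwalks_support k n : qwalks steps k n != 0%N ->
  [/\ in_quadrant k, k.1 <= n%:Z & k.2 <= n%:Z].
Proof.
elim: n k => [|n IH] k; first by rewrite qwalks0; have [->|] := eqVneq k 0.
rewrite qwalksS; case: ifP => // kq; rewrite sum_nat_seq_neq0.
move=> /hasP[s sS /IH[_ k1 k2]].
by split=> //; move: sS k1 k2; case: k kq => i j _;
  rewrite !inE -!orbA => /or4P[|||/orP[]] /eqP -> /=; lia.
Qed.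

Lemma qtotalE n : qtotal steps n =
  (\sum_(i < n.+1) \sum_(j < n.+1) qwalks steps (i%:Z, j%:Z) n)%N.
Proof.
pose box := [seq (i%:Z, j%:Z) | i <- index_iota 0 n.+1, j <- index_iota 0 n.+1].
transitivity (\sum_(k <- box) qwalks steps k n)%N; last first.
  rewrite /box big_allpairs_dep big_mkord; apply: eq_bigr => i _.
  by rewrite big_mkord.
have sub (s t : seq (int * int)) : uniq s -> uniq t ->
    (forall k, qwalks steps k n != 0%N -> k \in s) ->
    (forall k, qwalks steps k n != 0%N -> k \in t) ->
    (\sum_(k <- s) qwalks steps k n = \sum_(k <- t) qwalks steps k n)%N.
  move=> us ut ks kt; rewrite [LHS](bigID (fun k => qwalks steps k n != 0%N)).
  rewrite [RHS](bigID (fun k => qwalks steps k n != 0%N)) /=.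
  have z (l : seq (int * int)) :
      (\sum_(k <- l | ~~ (qwalks steps k n != 0)) qwalks steps k n = 0)%N.
    by rewrite big1 // => k /negPn/eqP.
  congr (_ + _)%N; last by rewrite (z s) (z t).
  rewrite -big_filter -[RHS]big_filter; apply: perm_big; apply: uniq_perm.
  - exact: filter_uniq.
  - exact: filter_uniq.
  by move=> k; rewrite !mem_filter; case: (boolP (qwalks steps k n != 0%N)) =>
    //= k0; rewrite ks ?kt.
apply: sub => [||k k0|k /qwalks_support].
- exact: fset_uniq.
- apply: allpairs_uniq; try exact: iota_uniq.
  by move=> [i j] [i' j'] _ _ [-> ->].
- by apply: contraNT k0 => /qwalks_eq0 ->.
case: k => i j [/andP[/= i0 j0] iN jN]; apply/allpairsP.
exists (`|i|%N, `|j|%N); rewrite /= !mem_index_iota.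
by split; [lia | lia | rewrite !gez0_abs].
Qed.

End Endpoints.

Section PolynomialTimesGeometric.
Variable R : realType.

Lemma sqr_mul_expr_le (x : R) : 0 < x < 1 -> exists K tau : R,
  [/\ 0 < K, 0 < tau < 1 & forall a, a%:R ^+ 2 * x ^+ a <= K * tau ^+ a].
Proof.
move=> /andP[x0 x1].
(* t is chosen with x <= t ^ 3, so that one factor t ^ a is left once each of
   the two factors a is absorbed by a factor t ^ a, see bern; the choice works
   because (1 + d) ^ 3 <= 1 + 7 d. *)
pose d := (1 - x) / 7; have d0 : 0 < d by rewrite divr_gt0 ?subr_gt0.
have d1 : d < 1 by rewrite /d; lra.
pose t := (1 + d)^-1; have t0 : 0 < t by rewrite invr_gt0; lra.
have dt : (1 + d) * t = 1 by rewrite divff // gt_eqF //; lra.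
have t1 : t < 1 by nra.
have xt : x <= t ^+ 3.
  have : x * (1 + d) ^+ 3 <= 1.
    have xE : x = 1 - 7 * d by rewrite /d; lra.
    rewrite xE; nra.
  have td : (1 + d) ^+ 3 * t ^+ 3 = 1 by rewrite -exprMn dt expr1n.
  by move=> xd; rewrite -[x]mulr1 -td mulrA ler_piMl ?exprn_ge0 // ltW.
have bern a : a%:R * d * t ^+ a <= 1.
  have : 1 + a%:R * d <= (1 + d) ^+ a.
    elim: a => [|a IH]; first by rewrite expr0 mul0r addr0.
    rewrite exprS -natr1; have : 0 <= a%:R :> R by [].
    have : (1 + d) * (1 + a%:R * d) <= (1 + d) * (1 + d) ^+ a.
      by rewrite ler_wpM2l //; lra.
    nra.
  move=> h; have h2 : a%:R * d <= (1 + d) ^+ a by lra.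
  have td : (1 + d) ^+ a * t ^+ a = 1 by rewrite -exprMn dt expr1n.
  by rewrite -[leRHS]td ler_wpM2r // exprn_ge0 // ltW.
exists (d^-1 ^+ 2), t; split; first by rewrite exprn_gt0 // invr_gt0.
  by rewrite t0.
move=> a; have dn : d != 0 by rewrite gt_eqF.
have -> : a%:R ^+ 2 * x ^+ a = d^-1 ^+ 2 * ((a%:R * d) ^+ 2 * x ^+ a).
  by rewrite exprMn mulrA mulrCA -exprMn mulVf // expr1n mulr1.
have d0' := ltW d0; have t0' := ltW t0; have x0' := ltW x0.
rewrite ler_wpM2l ?exprn_ge0 ?invr_ge0 //.
have ad0 : 0 <= a%:R * d * t ^+ a by rewrite mulr_ge0 ?exprn_ge0 // mulr_ge0.
apply: (@le_trans _ _ ((a%:R * d) ^+ 2 * (t ^+ 3) ^+ a)).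
  by rewrite ler_wpM2l ?sqr_ge0 // lerXn2r ?nnegrE ?exprn_ge0.
have -> : (a%:R * d) ^+ 2 * (t ^+ 3) ^+ a = (a%:R * d * t ^+ a) ^+ 2 * t ^+ a.
  by rewrite exprAC; ring.
by rewrite ler_piMl ?exprn_ge0 ?exprn_ile1.
Qed.

End PolynomialTimesGeometric.

Fact add_le_mul_succ (i j : nat) : (i + j + 2 <= 2 * i.+1 * j.+1)%N.
Proof.
have -> : (2 * i.+1 * j.+1 = i + j + 2 + (2 * (i * j) + i + j))%N by lia.
exact: leq_addr.
Qed.

Section WalkAsymptotics.
Variables (R : realType) (r : R).
Hypotheses (r12 : 1 < r < 2) (rE : r ^+ 4 = r + 3).
Local Open Scope classical_set_scope.

Let r0 : 0 < r. Proof. by case/andP: r12 => /(lt_trans _)->. Qed.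

Local Notation mu := (growth r).
Local Notation w := (r^-1 ^+ 4).

Let mu0 : 0 < mu. Proof. exact: growth_gt0. Qed.

Let w01 : 0 < w < 1.
Proof.
rewrite exprn_gt0 ?invr_gt0 //= exprn_ilt1 ?invr_ge0 ?ltW // invf_lt1 //.
by case/andP: r12.
Qed.

(** Coefficients of U S^n divided by their order of magnitude, which is
    mu^(n+1) / ((n+1)^2 tilt). *)
Definition tilted_refl n (a b : nat) : R :=
  n.+1%:R ^+ 2 * ratr (lcoef (refl_poly * step_poly ^+ n) (a%:Z, b%:Z))
  * tilt r (a%:Z, b%:Z) / mu ^+ n.+1.

Lemma tilted_refl_rec n a b :
  tilted_refl n a b + w * tilted_refl n a.+2 b =
  b%:R * (n.+1%:R * tilted_coef r n.+1 (a%:Z, b%:Z)).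
Proof.
have := congr1 (ratr : rat -> R) (free_refl_coef n a%:Z b%:Z).
rewrite 2!rmorphM rmorphD /= ratr_nat ratr_int => h.
have -> : tilted_refl n a.+2 b = r ^+ 4 * (n.+1%:R ^+ 2
  * ratr (lcoef (refl_poly * step_poly ^+ n) (a%:Z + 2, b%:Z))
  * tilt r (a%:Z, b%:Z) / mu ^+ n.+1).
  have aE : a.+2%:Z = a%:Z + 2 by rewrite -addn2 PoszD.
  have -> : r ^+ 4 = tilt r (2, 0) by [].
  rewrite /tilted_refl aE (_ : tilt r (a%:Z + 2, b%:Z) =
    tilt r (2, 0) * tilt r (a%:Z, b%:Z)); first by ring.
  by rewrite -tiltD //; congr tilt; congr pair; rewrite /= ?add0r // addrC.
have wr : w * r ^+ 4 = 1 by rewrite -exprMn mulVf ?expr1n // gt_eqF.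
rewrite [w * (_ * _)]mulrA wr mul1r /tilted_coef /tilted_refl.
transitivity (n.+1%:R * tilt r (a%:Z, b%:Z) / mu ^+ n.+1 * (n.+1%:R *
  (ratr (lcoef (refl_poly * step_poly ^+ n) (a%:Z, b%:Z)) +
   ratr (lcoef (refl_poly * step_poly ^+ n) (a%:Z + 2, b%:Z))))); first by ring.
by rewrite -h; ring.
Qed.

Lemma alternating_expansion (x : R) (v h : nat -> R) N :
  (forall i, v i + x * v i.+1 = h i) -> v N = 0 ->
  v 0%N = \sum_(i < N) (- x) ^+ i * h i.
Proof.
move=> vh vN; have : v 0%N = \sum_(i < N) (- x) ^+ i * h i + (- x) ^+ N * v N.
  elim: N {vN} => [|N IH]; first by rewrite big_ord0 add0r expr0 mul1r.
  by rewrite big_ord_recr IH /= -vh exprS; ring.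
by rewrite vN mulr0 addr0.
Qed.

(** The sum inverts the operator 1 + x^-2 of free_refl_coef; it is finite
    because coefficients with large abscissa vanish. *)
Lemma tilted_reflE n a b N : (n.+1 < a + N.*2)%N ->
  tilted_refl n a b = \sum_(i < N) (- w) ^+ i *
    (b%:R * (n.+1%:R * tilted_coef r n.+1 ((a + i.*2)%:Z, b%:Z))).
Proof.
move=> aN; have := @alternating_expansion w
  (fun i => tilted_refl n (a + i.*2) b) (fun i => b%:R * (n.+1%:R
    * tilted_coef r n.+1 ((a + i.*2)%:Z, b%:Z))) N.
rewrite addn0; apply.
  by move=> i; rewrite doubleS !addnS tilted_refl_rec.
by rewrite /tilted_refl refl_coef_eq0 ?ltz_nat // rmorph0 mulr0 !mul0r.
Qed.

Variables (c C : R).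
Hypothesis c0 : 0 < c.
Hypothesis C_bound : forall m k, `|m%:R * tilted_coef r m k| <= C.
Hypothesis c_lim : forall k, (fun m => m%:R * tilted_coef r m k) @ \oo --> c.

Let C0 : 0 <= C. Proof. exact: le_trans (normr_ge0 _) (C_bound 0 0). Qed.

Let term_bound n a b i :
  `|(- w) ^+ i * (b%:R * (n.+1%:R * tilted_coef r n.+1 ((a + i.*2)%:Z, b%:Z)))|
  <= b%:R * C * w ^+ i.
Proof.
case/andP: w01 => w0 _; rewrite normrM normrX normrN (gtr0_norm w0) mulrC.
apply: ler_wpM2r; first exact: (exprn_ge0 _ (ltW w0)).
rewrite normrM ger0_norm //.
by rewrite ler_wpM2l.
Qed.

Lemma tilted_refl_bound n a b : `|tilted_refl n a b| <= b%:R * C / (1 - w).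
Proof.
rewrite (@tilted_reflE n a b n.+2); last by lia.
apply: le_trans (ler_norm_sum _ _ _) _.
apply: (@le_trans _ _ (\sum_(i < n.+2) b%:R * C * w ^+ i)).
  by apply: ler_sum => i _; exact: term_bound.
rewrite -mulr_sumr ler_wpM2l ?mulr_ge0 // geometric_partial_sum //.
by case/andP: w01 => /ltW -> ->.
Qed.

Lemma tilted_refl_lim a b :
  (fun n => tilted_refl n a b) @ \oo --> b%:R * c / (1 + w).
Proof.
case/andP: w01 => w0 w1.
have -> : b%:R * c / (1 + w) = limn (series (geometric (b%:R * c) (- w))).
  apply/esym/cvg_lim => //; rewrite -[1 + w]/(1 + w) -{2}[w]opprK.
  by apply: cvg_geometric_series; rewrite normrN gtr0_norm.
have -> : (fun n => tilted_refl n a b) = (fun n => \sum_(i < n.+2) (- w) ^+ i *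
    (b%:R * (n.+1%:R * tilted_coef r n.+1 ((a + i.*2)%:Z, b%:Z)))).
  by apply/funext => n; apply: tilted_reflE; lia.
apply: (@tannery R (fun n i => (- w) ^+ i *
    (b%:R * (n.+1%:R * tilted_coef r n.+1 ((a + i.*2)%:Z, b%:Z))))
  (geometric (b%:R * C) w) _ (fun n => n.+2)) => //.
- by apply: is_cvg_geometric_series; rewrite gtr0_norm.
- move=> i; rewrite /= mulrC; apply: cvgMr; apply: cvgMr.
  by rewrite (cvg_shiftS (fun m => m%:R * tilted_coef r m _)).
by move=> n; exact: leqW.
Qed.

(** Equivalent to n^4 / mu^(n+3), but with the polynomial factors that occur in
    the exact formula for the numbers of walks. *)
Definition walk_scale n : R :=
  n.+1%:R * n.+2%:R * n.+3%:R ^+ 2 / mu ^+ n.+3.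

Lemma scaled_qwalksE n (i j : nat) :
  walk_scale n * (qwalks steps (i%:Z, j%:Z) n)%:R =
  i.+1%:R * (i + j + 2)%:R / tilt r (i.+1%:Z, j.+1%:Z)
  * tilted_refl n.+2 i.+1 j.+1.
Proof.
have := congr1 (ratr : rat -> R) (weighted_coefE n i%:Z j%:Z).
rewrite -qwalks_weighted //.
have -> : i%:Z + 1 = i.+1%:Z by rewrite -addn1 PoszD.
have -> : j%:Z + 1 = j.+1%:Z by rewrite -addn1 PoszD.
have -> : i%:Z + j%:Z + 2 = (i + j + 2)%N%:Z by rewrite !PoszD.
rewrite !rmorphM /= !ratr_nat => h; rewrite /walk_scale /tilted_refl.
transitivity (n.+3%:R ^+ 2 / mu ^+ n.+3 *
  (n.+1%:R * n.+2%:R * (qwalks steps (i%:Z, j%:Z) n)%:R)); first by ring.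
rewrite h; field; apply/andP; split; first by rewrite expf_neq0 // gt_eqF.
by rewrite gt_eqF // tilt_gt0.
Qed.

Lemma scaled_qwalks_lim (i j : nat) : exists2 l : R, 0 < l &
  (fun n => walk_scale n * (qwalks steps (i%:Z, j%:Z) n)%:R) @ \oo --> l.
Proof.
exists (i.+1%:R * (i + j + 2)%:R / tilt r (i.+1%:Z, j.+1%:Z)
  * (j.+1%:R * c / (1 + w))).
  case/andP: w01 => w0 _.
  by rewrite !mulr_gt0 ?invr_gt0 ?tilt_gt0 ?addr_gt0 ?ltr0n // addn2.
under eq_fun do rewrite scaled_qwalksE.
apply: cvgMr; have := @tilted_refl_lim i.+1 j.+1.
by rewrite -(cvg_shiftn 2); under eq_fun do rewrite addn2.
Qed.

Lemma scaled_qwalks_bound : exists K tau : R, 0 < tau < 1 /\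
  forall n i j, `|walk_scale n * (qwalks steps (i%:Z, j%:Z) n)%:R| <=
    K * tau ^+ i * tau ^+ j.
Proof.
have ri : 0 < r^-1 < 1 by rewrite invr_gt0 r0 invf_lt1 //; case/andP: r12.
have [K [tau [K0 tau01 sqK]]] := sqr_mul_expr_le ri.
case/andP: (tau01) => tau0 tau1; case/andP: ri => ri0 ri1.
case/andP: w01 => w0 w1.
exists (2 * K * K * (C / (1 - w))), tau; split => // n i j.
rewrite scaled_qwalksE tilt_nat normrM.
set a := i.+1; set b := j.+1.
have X0 : 0 <= a%:R * (i + j + 2)%:R / r ^+ (a.*2 + b).
  by apply: divr_ge0; [exact: mulr_ge0|apply: exprn_ge0; exact: ltW].
rewrite (ger0_norm X0).
apply: le_trans (ler_wpM2l X0 (tilted_refl_bound _ _ _)) _.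
have D0 : 0 <= C / (1 - w) by rewrite divr_ge0 // subr_ge0 ltW.
have -> : a%:R * (i + j + 2)%:R / r ^+ (a.*2 + b) * (b%:R * C / (1 - w)) =
    a%:R * (i + j + 2)%:R * b%:R * r^-1 ^+ (a.*2 + b) * (C / (1 - w)).
  rewrite [r^-1 ^+ (a.*2 + b)]exprVn; move: (r ^+ _)^-1 (1 - w)^-1 => P D.
  by ring.
have rho0 : 0 <= r^-1 by exact: ltW.
have K00 : 0 <= K by exact: ltW.
have tau00 : 0 <= tau by exact: ltW.
have sq (k : nat) : k.+1%:R ^+ 2 * r^-1 ^+ k.+1 <= K * tau ^+ k.
  apply: le_trans (sqK _) _; rewrite ler_wpM2l // exprS ler_piMl ?exprn_ge0 //.
  exact: ltW.
have -> : 2 * K * K * (C / (1 - w)) * tau ^+ i * tau ^+ j =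
    2 * ((K * tau ^+ i) * (K * tau ^+ j)) * (C / (1 - w)) by ring.
apply: ler_wpM2r => //.
apply: (@le_trans _ _
    (2 * ((a%:R ^+ 2 * r^-1 ^+ a) * (b%:R ^+ 2 * r^-1 ^+ b)))).
  have -> : 2 * (a%:R ^+ 2 * r^-1 ^+ a * (b%:R ^+ 2 * r^-1 ^+ b)) =
      a%:R * (2 * a * b)%:R * b%:R * r^-1 ^+ (a + b).
    by rewrite !natrM exprD; ring.
  apply: ler_pM.
  - by rewrite !mulr_ge0.
  - by rewrite exprn_ge0.
  - rewrite ler_wpM2r // ler_wpM2l // ler_nat /a /b.
    exact: add_le_mul_succ.
  - by rewrite -addnn -addnA exprD ler_piMl ?exprn_ge0 // exprn_ile1 // ltW.
rewrite ler_wpM2l //; apply: ler_pM; try exact: sq.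
  by rewrite mulr_ge0 ?sqr_ge0 // exprn_ge0.
by rewrite mulr_ge0 ?sqr_ge0 // exprn_ge0.
Qed.

(** Dominated convergence is applied to the sum over the ordinate and then to
    the sum over the abscissa of the endpoint; the limit is positive because it
    is at least the limit for the excursions. *)
Lemma scaled_qtotal_lim : exists2 l : R, 0 < l &
  (fun n => walk_scale n * (qtotal steps n)%:R) @ \oo --> l.
Proof.
have [K [tau [/andP[tau0 tau1] bound]]] := scaled_qwalks_bound.
pose f n i j : R := walk_scale n * (qwalks steps (i%:Z, j%:Z) n)%:R.
have f0 n i j : 0 <= f n i j.
  apply: mulr_ge0 => //; apply: divr_ge0; first by rewrite !mulr_ge0 ?sqr_ge0.
  by apply: exprn_ge0; exact: ltW.
have [g gP] : {g : nat -> nat -> R | forall i j, 0 < g i j /\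
    (fun n => f n i j) @ \oo --> g i j}.
  have h i j : {l : R | 0 < l /\ (fun n => f n i j) @ \oo --> l}.
    by apply: cid; have [l] := scaled_qwalks_lim i j; exists l.
  exists (fun i j => sval (h i j)) => i j.
  by case: (h i j).
have cgeo (x : R) : cvgn (series (geometric x tau)).
  by apply: is_cvg_geometric_series; rewrite gtr0_norm.
have K0 : 0 <= K.
  by apply: le_trans (normr_ge0 _) (le_trans (bound 0 0 0)%N _);
    rewrite !expr0 !mulr1.
have inner i : (fun n => \sum_(j < n.+1) f n i j) @ \oo --> limn (series (g i)).
  apply: (@tannery R (fun n j => f n i j) (geometric (K * tau ^+ i) tau) _
    (fun n => n.+1)) => //; first by move=> n j; exact: bound.
  by move=> j; case: (gP i j).
have outer : (fun n => \sum_(i < n.+1) \sum_(j < n.+1) f n i j) @ \oo -->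
    limn (series (fun i => limn (series (g i)))).
  apply: (@tannery R (fun n i => \sum_(j < n.+1) f n i j)
    (geometric (K / (1 - tau)) tau) _ (fun n => n.+1)) => // n i.
  apply: le_trans (ler_norm_sum _ _ _) _.
  apply: (@le_trans _ _ (\sum_(j < n.+1) K * tau ^+ i * tau ^+ j)).
    by apply: ler_sum => j _; exact: bound.
  have -> : geometric (K / (1 - tau)) tau i = K * tau ^+ i * (1 - tau)^-1.
    by rewrite /geometric /= mulrAC.
  rewrite -mulr_sumr; apply: ler_wpM2l.
    by apply: mulr_ge0 => //; apply: exprn_ge0; exact: ltW.
  by apply: geometric_partial_sum; rewrite ltW.
have totalE n : walk_scale n * (qtotal steps n)%:R =
    \sum_(i < n.+1) \sum_(j < n.+1) f n i j.
  rewrite qtotalE natr_sum mulr_sumr; apply: eq_bigr => i _.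
  by rewrite natr_sum mulr_sumr.
exists (limn (series (fun i => limn (series (g i))))); last first.
  by under eq_fun do rewrite totalE.
have [g0 flim] := gP 0%N 0%N; apply: lt_le_trans g0 _.
apply: (ler_cvg_to flim outer); apply: nearW => n.
rewrite big_ord_recl big_ord_recl /= -addrA lerDl addr_ge0 ?sumr_ge0 // => i _.
by rewrite sumr_ge0.
Qed.

End WalkAsymptotics.

(** * The exponents *)

Section Exponents.
Variables (R : realType) (r : R).
Hypotheses (r12 : 1 < r < 2) (rE : r ^+ 4 = r + 3).
Local Open Scope classical_set_scope.

Local Notation mu := (growth r).

Let mu0 : 0 < mu.
Proof. by apply: growth_gt0 => //; case/andP: r12 => /(lt_trans _)->. Qed.

Lemma ratio_succ_lim k :
  (fun n => n%:R / (n + k.+1)%:R : R) @ \oo --> (1 : R).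
Proof.
have lim : (fun n => 1 - k.+1%:R * harmonic (n + k)%N : R) @ \oo -->
    (1 - k.+1%:R * 0 : R).
  apply: cvgB; first exact: cvg_cst.
  by apply: cvgMr; rewrite cvg_shiftn; exact: cvg_harmonic.
rewrite mulr0 subr0 in lim; apply: cvg_trans lim; apply: near_eq_cvg.
apply: nearW => n; rewrite /harmonic /= -addnS.
have nk : (n + k.+1)%:R != 0 :> R by rewrite addnS pnatr_eq0.
apply: (mulIf nk); rewrite mulrBl mulfVK // divfK // natrD; ring.
Qed.

Lemma growth_rate_of_scale (X : nat -> R) (l : R) :
  (fun n => walk_scale r n * X n) @ \oo --> l ->
  (fun n => X n / (mu ^+ n * n%:R `^ (- 4))) @ \oo --> l * mu ^+ 3.
Proof.
move=> Xl; pose rho n : R := n%:R / (n + 1)%:R * (n%:R / (n + 2)%:R) *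
  (n%:R / (n + 3)%:R * (n%:R / (n + 3)%:R)).
have rho1 : rho @ \oo --> (1 : R).
  have := cvgM (cvgM (ratio_succ_lim 0) (ratio_succ_lim 1))
    (cvgM (ratio_succ_lim 2) (ratio_succ_lim 2)).
  by rewrite !mulr1; exact.
have lim : (fun n => walk_scale r n * X n * mu ^+ 3 * rho n) @ \oo -->
    l * mu ^+ 3 * 1.
  by apply: cvgM => //; apply: cvgM => //; exact: cvg_cst.
rewrite mulr1 in lim.
apply: cvg_trans lim; apply: near_eq_cvg; near=> n.
have n0 : (0 < n)%N by near: n; exact: nbhs_infty_gt.
have nn0 : n%:R != 0 :> R by rewrite pnatr_eq0 -lt0n.
rewrite powR_invn // /walk_scale /rho !addnS addn0.
have a1 : n.+1%:R != 0 :> R by rewrite pnatr_eq0.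
have a2 : n.+2%:R != 0 :> R by rewrite pnatr_eq0.
have a3 : n.+3%:R != 0 :> R by rewrite pnatr_eq0.
have mun : mu ^+ n != 0 by rewrite expf_neq0 // gt_eqF.
have m0 : mu != 0 by rewrite gt_eqF.
rewrite -[n.+3]addn3 exprD addn3.
move: (n.+1%:R) (n.+2%:R) (n.+3%:R) a1 a2 a3 => a b d a1 a2 a3.
by field; rewrite a1 a2 a3 mun m0 nn0.
Unshelve. all: by end_near. Qed.

(** (0, 1) + (1, -1) + (-1, 0) = 0 and 2 (0, 1) + (1, -1) + (-1, -1) = 0 are
    closed walks of coprime lengths. *)
Lemma steps_period : is_period steps 1.
Proof.
split=> [n _|d dvd]; first exact: dvd1n.
pose st (i j : int) (h : (i, j) \in steps) : steps := [` h]%fset.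
have a : (0 : int, 1 : int) \in steps by rewrite !inE.
have b : (1 : int, -1 : int) \in steps by rewrite !inE.
have c : (-1 : int, -1 : int) \in steps by rewrite !inE.
have e : (-1 : int, 0 : int) \in steps by rewrite !inE.
have d3 : (d %| 3)%N.
  apply: dvd; exists [tuple st _ _ a; st _ _ b; st _ _ e].
  by rewrite /walk_pos /= !big_cons big_nil.
have d4 : (d %| 4)%N.
  apply: dvd; exists [tuple st _ _ a; st _ _ a; st _ _ b; st _ _ c].
  by rewrite /walk_pos /= !big_cons big_nil.
by have := dvdn_sub d4 d3.
Qed.

Lemma steps_excursion_exponent : excursion_exponent steps (- 4 : R).
Proof.
have [c c0 [[C Cb] clim]] := tilted_local_limit r12 rE.
have [l l0 /growth_rate_of_scale] := scaled_qwalks_lim r12 c0 Cb clim 0 0.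
set y := (X in X @ _ --> _); set L := l * mu ^+ 3 => yL.
have L0 : 0 < L by rewrite mulr_gt0 // exprn_gt0.
exists 1%N, mu, (L / 2), (2 * L); split => //; first exact: steps_period.
- by rewrite divr_gt0.
- by rewrite mulr_gt0.
have L1 : L / 2 < L by lra.
have L2 : L < 2 * L by lra.
near=> n => _.
have n0 : (0 < n)%N by near: n; exact: nbhs_infty_gt.
have e0 : 0 < mu ^+ n * n%:R `^ (- 4).
  by rewrite mulr_gt0 ?exprn_gt0 // powR_gt0 // ltr0n.
rewrite -!(mulrA _ (mu ^+ n)) -ler_pdivlMr // -[X in _ && X]ler_pdivrMr //.
apply/andP; split.
  have y1 : L / 2 <= y n by near: n; exact: (cvgr_ge L yL).
  exact: y1.
have y2 : y n <= 2 * L by near: n; exact: (cvgr_le L yL).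
exact: y2.
Unshelve. all: by end_near. Qed.

Lemma steps_walk_exponent : walk_exponent steps (- 4 : R).
Proof.
have [c c0 [[C Cb] clim]] := tilted_local_limit r12 rE.
have [l l0 /growth_rate_of_scale] := scaled_qtotal_lim r12 c0 Cb clim.
set y := (X in X @ _ --> _); set L := l * mu ^+ 3 => yL.
have L0 : 0 < L by rewrite mulr_gt0 // exprn_gt0.
exists mu, (fun=> L); split => //; first by exists 1%N.
apply/eqaddoP => eps eps0; near=> n.
have n0 : (0 < n)%N by near: n; exact: nbhs_infty_gt.
have e0 : 0 < mu ^+ n * n%:R `^ (- 4).
  by rewrite mulr_gt0 ?exprn_gt0 // powR_gt0 // ltr0n.
have yn : `|L - y n| <= eps * L.
  by near: n; move/cvgrPdist_le : yL; apply; rewrite mulr_gt0.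
set e := mu ^+ n * _ in e0.
have Xn : (qtotal steps n)%:R = y n * e by rewrite divfK // gt_eqF.
have -> : ((fun n => (qtotal steps n)%:R : R^o) -
    (fun n => L * mu ^+ n * n%:R `^ (- 4) : R^o)) n = (y n - L) * e.
  by rewrite mulrBl -Xn mulrA.
rewrite /= -(mulrA L) -/e (normrM _ e) (normrM L e).
rewrite (gtr0_norm L0) (gtr0_norm e0).
rewrite (mulrA eps) (distrC (y n)).
by rewrite ler_wpM2r // ltW.
Unshelve. all: by end_near. Qed.

End Exponents.

Theorem proposition25 (R : realType) :
  (forall n : nat,
     Qgf steps n =
     nonneg_part
       (ps_mul
          (ps_const ((ly ^+ 2 - lx)
                     * (lx ^+ 2 * ly ^+ 2 - lx * ly - ly ^+ 2 - 2 * lx)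
                     * (lx ^+ 3 - lx * ly - 2 * ly ^+ 2 - lx)
                     * (lxV ^+ 5 * lyV ^+ 4)))
          (ps_inv
             (ps_sub (ps_const 1)
                (ps_mul (ps_t laurent)
                   (ps_const (ly + lx * lyV + lxV * lyV + lxV ^+ 2 * ly + lxV)))))
          n))
  /\ excursion_exponent steps (- 4 : R)
  /\ walk_exponent steps (- 4 : R).
Proof.
split=> [n|].
  rewrite Qgf_weighted; congr nonneg_part.
  by rewrite ps_mul_const ps_inv_geometric.
have [r r12 rE] := critical_point R.
split; first exact: steps_excursion_exponent r12 rE.
exact: steps_walk_exponent r12 rE.
Qed.
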